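(* Let $N,L,D$ be positive integers and let $\mathbf{A}(x)=A_0+xA_1+\cdots+x^DA_D\in\mathrm{M}_{L\times N}(\mathbb{Z}[x])$ (with $A_d\in\mathrm{M}_{L\times N}(\mathbb{Z})$) satisfy: (a) the columns of $\mathbf{A}_{\ast}(x)=\mathbf{A}(x)-A_0$ are $\mathbb{Q}$-linearly independent, and (b) whenever $\mathbf{v}\in\mathbb{Q}^L$, $\mathbf{w}\in\mathbb{Q}^N$ satisfy $\mathbf{v}\cdot A_d\mathbf{w}=0$ for each $d=1,\dots,D$, then $\mathbf{v}\cdot A_0\mathbf{w}=0$. Then there are constants $c_1(N,L,D)$, $c_2(N,L,D)$ and $C(N,L,D)$, depending only on $N,L,D$, such that for every $\epsilon>0$, $$k(\epsilon;L,N,\mathbf{A})\le C(N,L,D)\,\|\mathbf{A}_{\ast}\|_{\infty}^{c_1(N,L,D)}\left(\frac{1}{\epsilon}\right)^{c_2(N,L,D)}.$$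
   Context: $\mathbb{T}=\mathbb{R}/\mathbb{Z}$; points of $\mathbb{T}^m$ are identified with representatives in $[0,1)^m$, and integer matrices act by left multiplication. A subtorus of $\mathbb{T}^L$ is a non-trivial closed connected Lie subgroup. For $\mathbf{x}\in\mathbb{R}^L$, $\|\mathbf{x}\|$ is the sup-norm distance from $\mathbf{x}$ to $\mathbb{Z}^L$. A set $Y\subset\mathbb{T}^L$ is $\epsilon$-dense in $S\subset\mathbb{T}^L$ if for every $\mathbf{s}\in S$ there is $\mathbf{y}\in Y\cap S$ with $\|\mathbf{y}-\mathbf{s}\|\le\epsilon$. $k(\epsilon;L,N,\mathbf{A})$ is the largest integer $k$ such that there exist $k$ distinct points $X=\{\mathbf{x}_1,\dots,\mathbf{x}_k\}\subset\mathbb{T}^N$ for which $\mathbf{A}(n)X$ is not $\epsilon$-dense in any translate of any subtorus of $\mathbb{T}^L$, for every $n=1,2,3,\dots$. $\|\mathbf{A}_\ast\|_\infty$ is the maximum of the heights (maximum absolute value of coefficients) of the entries of $\mathbf{A}_\ast$, i.e. $\max_{1\le d\le D}\max_{i,j}|(A_d)_{ij}|$. *)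

(* Defs.v *)
From HB Require Import structures.
From mathcomp Require Import all_boot all_order all_algebra.
From mathcomp Require Import all_classical all_reals all_analysis.
Import Order.TTheory GRing.Theory Num.Theory.
Import numFieldNormedType.Exports.
Set Implicit Arguments.
Unset Strict Implicit.
Unset Printing Implicit Defensive.
Local Open Scope ring_scope.
Local Open Scope classical_set_scope.

Definition integers (R : realType) : {pred R} := fun x => x \is a Num.int.

Lemma integers_zmod_closed (R : realType) : zmod_closed (@integers R).
Proof. by split=> [|x y]; [exact: rpred0|exact: rpredB]. Qed.

HB.instance Definition _ (R : realType) :=
  GRing.isZmodClosed.Build R (@integers R) (@integers_zmod_closed R).

(* R/Z, with its quotient group structure and quotient topology. *)
Definition circle (R : realType) : Type := Quotient.quot (@integers R).

HB.instance Definition _ (R : realType) :=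
  Choice.copy (circle R) (Quotient.quot (@integers R)).
HB.instance Definition _ (R : realType) :=
  EqQuotient.copy (circle R) (Quotient.quot (@integers R)).
HB.instance Definition _ (R : realType) :=
  GRing.Zmodule.copy (circle R) (Quotient.quot (@integers R)).
HB.instance Definition _ (R : realType) :=
  @isZmodQuotient.Build R (Quotient.equiv (@integers R)) 0 -%R +%R (circle R)
    (lock _) (@Quotient.pi_opp R (@integers R)) (@Quotient.pi_add R (@integers R)).

Section circle_topology.
Variable R : realType.
Let circle_open : set_system (circle R) :=
  @quotient_open R (Quotient.quot (@integers R)).

Let circle_openT : circle_open setT.
Proof. by rewrite /circle_open /quotient_open preimage_setT; exact: openT. Qed.

Let circle_openI (A B : set (circle R)) :
  circle_open A -> circle_open B -> circle_open (A `&` B).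
Proof. exact: openI. Qed.

Let circle_open_bigU (I : Type) (f : I -> set (circle R)) :
  (forall i, circle_open (f i)) -> circle_open (\bigcup_i f i).
Proof. by move=> ofi; apply: bigcup_open => i _; exact: ofi. Qed.

HB.instance Definition _ := isOpenTopological.Build (circle R)
  circle_openT circle_openI circle_open_bigU.
End circle_topology.

(* T^n = (R/Z)^n, with the coordinatewise group structure and the product
   topology that matrices over [circle R] inherit from [circle R]. *)
Notation torus R n := 'cV[circle R]_n.

Definition torus_mul (R : realType) m n (M : 'M[int]_(m, n)) (x : torus R n) :
    torus R m :=
  \col_i \sum_j x j 0 *~ M i j.

(* The norm of a real matrix is the sup-norm. *)
Definition dist_int (R : realType) n (x : 'cV[R]_n) : R :=
  inf [set `|x - map_mx intr z| | z in [set: 'cV[int]_n]].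

(* Since [dist_int] is invariant under integer translations, the choice of
   representatives made by [repr] (not necessarily in [0, 1)) is immaterial. *)
Definition torus_norm (R : realType) n (x : torus R n) : R :=
  dist_int (map_mx (repr : circle R -> R) x).

(* A closed subgroup of a Lie group is automatically a Lie subgroup (Cartan),
   so "closed connected Lie subgroup" needs no separate smoothness clause. *)
Definition subtorus (R : realType) n (H : set (torus R n)) : Prop :=
  [/\ H 0, forall x y, H x -> H y -> H (x - y), H <> [set 0],
      closed H & connected H].

Definition translate (R : realType) n (t : torus R n) (H : set (torus R n)) :
    set (torus R n) :=
  [set t + h | h in H].

Definition eps_dense (R : realType) n (eps : R) (Y S : set (torus R n)) : Prop :=
  forall s, S s -> exists2 y, (Y `&` S) y & torus_norm (y - s) <= eps.

Definition coef_mx L N (A : 'M[{poly int}]_(L, N)) (d : nat) : 'M[int]_(L, N) :=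
  map_mx (coefp d) A.

Definition eval_mx L N (A : 'M[{poly int}]_(L, N)) (n : nat) : 'M[int]_(L, N) :=
  map_mx (fun p : {poly int} => p.[n%:Z]) A.

Definition star_mx L N (A : 'M[{poly int}]_(L, N)) : 'M[{poly int}]_(L, N) :=
  A - map_mx polyC (coef_mx A 0).

Definition height (p : {poly int}) : nat := (\max_(d < size p) absz (p`_d)%R)%N.

Definition height_mx L N (A : 'M[{poly int}]_(L, N)) : nat :=
  (\max_i \max_j height (A i j))%N.

Definition columns_Qfree L N (B : 'M[{poly int}]_(L, N)) : Prop :=
  forall w : 'I_N -> rat,
    \sum_j (w j)%:P *: col j (map_mx (map_poly (intr : int -> rat)) B) = 0 ->
    forall j, w j = 0.

Definition coef_mxQ L N (A : 'M[{poly int}]_(L, N)) (d : nat) : 'M[rat]_(L, N) :=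
  map_mx intr (coef_mx A d).

Definition admissible (R : realType) (eps : R) L N (A : 'M[{poly int}]_(L, N))
    (k : nat) : Prop :=
  exists x : 'I_k -> torus R N, injective x /\
    forall n : nat, (1 <= n)%N ->
      forall (H : set (torus R L)) (t : torus R L), subtorus H ->
        ~ eps_dense eps (range (fun i => torus_mul (eval_mx A n) (x i)))
                        (translate t H).

(* The number k(eps; L, N, A), as a relation: the largest integer need not
   exist for an arbitrary A. *)
Definition is_k (R : realType) (eps : R) L N (A : 'M[{poly int}]_(L, N))
    (k : nat) : Prop :=
  admissible eps A k /\ forall k', admissible eps A k' -> (k' <= k)%N.

(* Main.v *)
(** Let T bound both the height of A_* and 1/eps; every quantity below is at most
a fixed power of T, so only "polynomial in T" has to be tracked.

If A(n)X is not eps-dense in the whole torus, testing against the Fejer kernel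
gives a bounded frequency u <> 0 whose exponential sum over A(n)X is a large
part of |X|.  Square, sum over u and average over n: for some u and a positive
proportion of pairs (x, x'), the sequence e(u . A(n)(x - x')) has a large mean.
By van der Corput differencing a bounded multiple of n |-> u . A(n)(x - x') is
then constant in R/Z, so a bounded multiple v of u satisfies
v . A_d (x - x') = 0 for 1 <= d <= D, and also for d = 0 by (b) and Cramer's rule.
Hence a positive proportion X' of X has A(n)X' in a translate of the subtorus
orthogonal to v, which has dimension L - 1; dividing the points of X' by a
coordinate of v presents it as the image of T^(L-1) under a bounded integer
matrix, and induction on L applies.  In the end A_d (x - x') = 0 for all d, and
by (a) only boundedly many points are left. *)

Require Import Defs.
From HB Require Import structures.
From mathcomp Require Import all_boot all_order all_algebra perm.
From mathcomp Require Import all_classical all_reals all_analysis.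
From mathcomp Require Import ring lra zify.
Import Order.TTheory GRing.Theory Num.Theory.
Import numFieldNormedType.Exports.
Set Implicit Arguments.
Unset Strict Implicit.
Unset Printing Implicit Defensive.
Local Open Scope ring_scope.
Local Open Scope classical_set_scope.

(** * The circle and its trigonometric functions *)

(** Two uniformity problems shape the argument. The point s missed by A(n)X and the frequency that
    detects it both change with n. Differences of points remove s; the squared moduli, being
    nonnegative, can be summed over the whole box of frequencies, which gives a lower bound
    independent of n, and only then does a mean over n single out one u. The mean is an exactly
    shift-invariant functional, so van der Corput differencing has no boundary terms and no rate in
    n is needed. Second, the height of A_0 is unrestricted and must not enter the bound. Cramer's
    rule is therefore arranged so that the multiplier is a minor of the rows v A_d with d >= 1,
    whatever the size of v A_0. Division by a coordinate of v is ambiguous up to torsion, so each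
    induction step pays one more pigeonhole, over the torsion classes of the D + 1 values of v .
    A_d; there are polynomially many because v is bounded. *)

Section Circle.
Variable R : realType.

Definition toc (a : R) : circle R := \pi_(circle R)%qT a.

Lemma toc_is_zmod_morphism : zmod_morphism toc.
Proof.
by move=> a b; rewrite /toc [LHS]pi_is_zmod_morphism.
Qed.

HB.instance Definition _ :=
  GRing.isZmodMorphism.Build R (circle R) toc toc_is_zmod_morphism.

Lemma reprK_toc (x : circle R) : toc (repr x) = x.
Proof. exact: reprK. Qed.

Lemma toc_eq (a b : R) : toc a = toc b <-> (a - b \is a Num.int).
Proof.
rewrite /toc; split.
  by move/eqP; rewrite -Quotient.idealrBE.
by move=> h; apply/eqP; rewrite -Quotient.idealrBE.
Qed.

Lemma toc0 : toc 0 = 0. Proof. exact: raddf0. Qed.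
Lemma tocD a b : toc (a + b) = toc a + toc b. Proof. exact: raddfD. Qed.
Lemma tocN a : toc (- a) = - toc a. Proof. exact: raddfN. Qed.
Lemma tocMn a n : toc (a *+ n) = toc a *+ n. Proof. exact: raddfMn. Qed.
Lemma tocMz a z : toc (a *~ z) = toc a *~ z. Proof. exact: raddfMz. Qed.

Definition cosc (x : circle R) : R := cos (pi *+ 2 * repr x).
Definition sinc (x : circle R) : R := sin (pi *+ 2 * repr x).

End Circle.

Section CircleTrig.
Variable R : realType.
Implicit Types x y : circle R.

Lemma cosDint (a : R) (z : int) : cos (a + pi *+ 2 * z%:~R) = cos a.
Proof.
have h (b : R) (n : nat) : cos (b + pi *+ 2 * n%:R) = cos b.
  by rewrite mulr_natr (periodicn (@cosD2pi R)).
case: z => n; first exact: h.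
by rewrite NegzE mulrNz mulrN -(h _ n.+1) subrK.
Qed.

Lemma sinDint (a : R) (z : int) : sin (a + pi *+ 2 * z%:~R) = sin a.
Proof. by rewrite -!cosBpihalf addrAC cosDint. Qed.

Lemma repr_toc (a : R) : exists z : int, repr (toc a) = a + z%:~R.
Proof.
have /toc_eq/intrP[z hz] : toc (repr (toc a)) = toc a by rewrite reprK_toc.
by exists z; rewrite -hz addrC subrK.
Qed.

Lemma cosc_toc (a : R) : cosc (toc a) = cos (pi *+ 2 * a).
Proof. by have [z ez] := repr_toc a; rewrite /cosc ez mulrDr cosDint. Qed.

Lemma sinc_toc (a : R) : sinc (toc a) = sin (pi *+ 2 * a).
Proof. by have [z ez] := repr_toc a; rewrite /sinc ez mulrDr sinDint. Qed.

Lemma cosc0 : cosc (0 : circle R) = 1.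
Proof. by rewrite -toc0 cosc_toc mulr0 cos0. Qed.

Lemma sinc0 : sinc (0 : circle R) = 0.
Proof. by rewrite -toc0 sinc_toc mulr0 sin0. Qed.

Lemma coscD x y : cosc (x + y) = cosc x * cosc y - sinc x * sinc y.
Proof.
rewrite -(reprK_toc x) -(reprK_toc y) -tocD.
by rewrite !cosc_toc !sinc_toc mulrDr cosD.
Qed.

Lemma sincD x y : sinc (x + y) = sinc x * cosc y + cosc x * sinc y.
Proof.
rewrite -(reprK_toc x) -(reprK_toc y) -tocD.
by rewrite !cosc_toc !sinc_toc mulrDr sinD.
Qed.

Lemma coscN x : cosc (- x) = cosc x.
Proof.
by rewrite -(reprK_toc x) -tocN !cosc_toc mulrN cosN.
Qed.

Lemma sincN x : sinc (- x) = - sinc x.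
Proof.
by rewrite -(reprK_toc x) -tocN !sinc_toc mulrN sinN.
Qed.

Lemma coscB x y : cosc (x - y) = cosc x * cosc y + sinc x * sinc y.
Proof. by rewrite coscD coscN sincN mulrN opprK. Qed.

Lemma cosc2Dsinc2 x : cosc x ^+ 2 + sinc x ^+ 2 = 1.
Proof. exact: cos2Dsin2. Qed.

Lemma cosc_max x : `|cosc x| <= 1.
Proof. exact: cos_max. Qed.

Lemma sinc_max x : `|sinc x| <= 1.
Proof. exact: sin_max. Qed.

Lemma circle_half x : exists2 w : R, toc w = x & `|w| <= 1 / 2.
Proof.
exists (repr x + 2^-1 - (Num.floor (repr x + 2^-1))%:~R - 2^-1).
  rewrite -[RHS]reprK_toc; apply/toc_eq.
  set f := Num.floor _; have -> : repr x + 2^-1 - f%:~R - 2^-1 - repr x = - f%:~R by ring.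
  by rewrite rpredN intr_int.
have := Num.Theory.floor_itv (repr x + 2^-1) => /andP[h1 h2].
rewrite intrD in h2.
by rewrite ler_norml; apply/andP; split; lra.
Qed.

(** By the mean value theorem sin y = y cos c with 0 < c < y, and cos (2c) >= 0 forces cos^2 c >=
    1/2. *)
Lemma sin_ge_half (y : R) : 0 <= y <= pi / 4 -> y ^+ 2 / 2 <= sin y ^+ 2.
Proof.
move=> /andP[y0 y4].
have hpi := pi_gt0 R.
move: y0; rewrite le_eqVlt => /orP[/eqP<-|y0]; first by rewrite expr0n mul0r sqr_ge0.
have [c] := @MVT R sin cos 0 y y0 (fun z _ => is_derive_sin z)
  (continuous_subspaceT (@continuous_sin R)).
rewrite in_itv /= => /andP[c0 cy]; rewrite sin0 !subr0 => ->.
have h2 : 0 <= cos (c *+ 2).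
  by apply: cos_ge0_pihalf; apply/andP; split; lra.
rewrite cos_mulr2n in h2.
have hc : 1 / 2 <= cos c ^+ 2 by lra.
by rewrite exprMn mulrC ler_wpM2r ?sqr_ge0 //; lra.
Qed.

Lemma cosc_far x (eps : R) : 0 < eps -> eps <= 1 / 2 ->
  ~ (exists2 w, toc w = x & `|w| <= eps) -> eps ^+ 2 <= 1 - cosc x.
Proof.
move=> e0 e1 hx.
have [w hw w2] := circle_half x.
have ew : eps < `|w| by rewrite ltNge; apply/negP => h; apply: hx; exists w.
have hpi := pi_gt0 R; have hpi2 := pi_ge2 R.
have -> : cosc x = cos ((pi * `|w|) *+ 2).
  by rewrite -hw cosc_toc -mulrnAl -cos_norm normrM gtr0_norm // pmulrn_lgt0.
rewrite cos_mulr2n cos2sin2.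
(* The comparison is made at pi eps / 2, half the available angle, so as to stay within [0, pi/4];
   pi >= 2 makes up for the loss. *)
have h1 := @sin_ge_half (pi * eps / 2).
have h2 : 0 <= pi * eps by rewrite mulr_ge0 // ltW.
have h3 : pi * eps <= pi / 2 by have := ler_wpM2l (ltW hpi) e1; lra.
have {}h1 := h1 ltac:(apply/andP; split; lra).
have h4 : pi * eps < pi * `|w| by rewrite ltr_pM2l.
have h5 : pi * `|w| <= pi / 2 by have := ler_wpM2l (ltW hpi) w2; lra.
have h6 : sin (pi * eps / 2) < sin (pi * `|w|).
  by rewrite ltr_sin ?in_itv /=; [lra|apply/andP; split; lra|apply/andP; split; lra].
have h7 : 0 <= sin (pi * eps / 2).
  by apply: sin_ge0_pi; apply/andP; split; lra.
have h8 : sin (pi * eps / 2) ^+ 2 <= sin (pi * `|w|) ^+ 2.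
  by rewrite lerXn2r ?nnegrE // ltW // (le_lt_trans h7).
have h9 : eps <= pi * eps / 2 by have := ler_wpM2r (ltW e0) hpi2; lra.
have h10 : eps ^+ 2 <= (pi * eps / 2) ^+ 2.
  by rewrite lerXn2r ?nnegrE //; lra.
by rewrite mulr2n; lra.
Qed.

Lemma cosc_eq1 x : cosc x = 1 -> x = 0.
Proof.
move=> hc.
have hfar (eps : R) : 0 < eps -> eps <= 1 / 2 -> exists2 w, toc w = x & `|w| <= eps.
  move=> e0 e1; apply: contrapT => /(cosc_far e0 e1).
  by rewrite hc subrr leNgt exprn_gt0.
have [w hw w2] := circle_half x.
have [->//|w0] := eqVneq x 0.
have wn0 : 0 < `|w|.
  by rewrite normr_gt0; apply: contra_neq w0 => w0; rewrite -hw w0 toc0.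
have [] := hfar (`|w| / 2); [lra|lra|] => v hv v2.
have /toc_eq/intrP[z hz] : toc w = toc v by rewrite hw hv.
have hz1 : `|(z%:~R : R)| < 1.
  by rewrite -hz (le_lt_trans (ler_normB _ _)) //; lra.
have z0 : z = 0.
  apply/eqP; rewrite -normr_le0 -ltzD1 add0r.
  by move: hz1; rewrite -intr_norm -[1]/(1%:~R) ltr_int.
move: hz; rewrite z0 => /eqP; rewrite subr_eq0 => /eqP hz.
by exfalso; move: v2 wn0; rewrite -hz; clear; lra.
Qed.

Lemma circle_divr (x : circle R) (q : int) : q != 0 -> exists y, y *~ q = x.
Proof.
move=> q0; exists (toc (repr x / q%:~R)).
by rewrite -tocMz -mulrzr divfK ?intr_eq0 // reprK_toc.
Qed.

(** The q-torsion points are the i/q. The result is phrased as a colouring defined everywhere and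
    faithful on torsion, the form that pigeonhole and injectivity counts consume. *)
Lemma circle_torsion (q : nat) : (0 < q)%N ->
  exists f : circle R -> 'I_q, forall x y, x *+ q = 0 -> y *+ q = 0 -> f x = f y -> x = y.
Proof.
move=> q0.
have H (x : circle R) : exists i : 'I_q, x *+ q = 0 -> x = toc (i%:R / q%:R).
  have [xq|h] := pselect (x *+ q = 0); last by exists (Ordinal q0) => /h.
  have /intrP[z hz] : repr x * q%:R - 0 \is a Num.int.
    by apply/toc_eq; rewrite mulr_natr tocMn toc0 reprK_toc.
  have hm : (absz (z %% q)%Z < q)%N.
    have := ltz_pmod z (d := q) => /(_ q0).
    have := modz_ge0 z (d := q); lia.
  exists (Ordinal hm) => _ /=.
  rewrite -[LHS]reprK_toc; apply/toc_eq.
  have qn0 : (q%:R : R) != 0 by rewrite pnatr_eq0 -lt0n.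
  have -> : repr x = z%:~R / q%:R.
    by rewrite -hz subr0 mulfK.
  have e : (absz (z %% q)%Z)%:R = ((z %% q)%Z)%:~R :> R.
    by rewrite -[in RHS](gez0_abs (modz_ge0 _ _)) //; lia.
  rewrite e [in X in X - _](divz_eq z q) rmorphD rmorphM /= mulrDl addrK.
  by rewrite mulfK // intr_int.
have [f hf] := choice H.
by exists f => x y xq yq e; rewrite (hf x xq) (hf y yq) e.
Qed.

End CircleTrig.

(** * Shift-invariant means *)

Section Mean.
Variable R : realType.
Implicit Types u v : nat -> R.

Definition seq_bounded u := exists B, forall n, `|u n| <= B.

(** A Banach limit. Values on unbounded sequences are arbitrary, hence the boundedness premises. *)
Record mean := Mean {
  mean_fun :> (nat -> R) -> R;
  mean_linear : forall u v a, seq_bounded u -> seq_bounded v ->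
    mean_fun (fun n => u n + a * v n) = mean_fun u + a * mean_fun v;
  mean_ge0 : forall u, seq_bounded u -> (forall n, 0 <= u n) -> 0 <= mean_fun u;
  mean_one : mean_fun (fun=> 1) = 1;
  mean_shift : forall u, seq_bounded u -> mean_fun (fun n => u n.+1) = mean_fun u
}.

Lemma ultra_map (T U : Type) (f : T -> U) (F : set_system T) :
  UltraFilter F -> UltraFilter (f @ F).
Proof.
move=> FU; split=> [|G GF sFG]; first exact: fmap_proper_filter.
rewrite predeqE => A; split; last exact: sFG.
move=> GA; have [//|FnA] := in_ultra_setVsetC (f @^-1` A) FU.
have GnA : G (~` A) by apply: sFG; rewrite /fmap /= preimage_setC.
by have /filter_ex [? []] : G (A `&` (~` A)) by exact: filterI.
Qed.

Lemma ultra_bounded_cvg (G : set_system nat) (a : nat -> R) (B : R) :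
  UltraFilter G -> (forall n, `|a n| <= B) -> cvg (a @ G).
Proof.
move=> GU ha.
have hc := @segment_compact R (- B) B; rewrite compact_ultra in hc.
have GaU := ultra_map a GU.
have [|l [_ hl]] := hc _ GaU; last by apply/cvg_ex; exists l.
apply: (@filterE _ G _ (a @^-1` `[- B, B]%classic)) => n /=.
by have := ha n; rewrite ler_norml in_itv.
Qed.

Definition cesaro u (n : nat) : R := (\sum_(i < n) u i) / n%:R.

Lemma cesaro_bounded u B : (forall n, `|u n| <= B) -> forall n, `|cesaro u n| <= B.
Proof.
move=> hu n; have B0 : 0 <= B by apply: le_trans (hu 0%N).
case: n => [|n]; first by rewrite /cesaro big_ord0 mul0r normr0.
rewrite /cesaro normrM normfV normr_nat ler_pdivrMr ?ltr0n //.
apply: le_trans (ler_norm_sum _ _ _) _.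
apply: (@le_trans _ _ (\sum_(i < n.+1) B)); first by apply: ler_sum.
by rewrite sumr_const card_ord mulr_natr.
Qed.

(* The limit of Cesaro averages along an ultrafilter finer than [\oo]; it gives
   exact identities where limits superior would only give inequalities. *)
Lemma mean_exists : exists M : mean, True.
Proof.
have [G [GU Goo]] := @ultraFilterLemma _ (\oo : set_system nat) _.
have GP : ProperFilter G by exact: ultra_proper.
have cv u : seq_bounded u -> cvg (cesaro u @ G).
  by move=> [B hB]; apply: (ultra_bounded_cvg (B := B) GU); exact: cesaro_bounded.
have Glim u l : cesaro u @ \oo --> l -> lim (cesaro u @ G) = l.
  by move=> h; apply: cvg_lim => //; apply: cvg_trans h; exact: cvg_app.
unshelve eexists; last by [].
apply: (@Mean (fun u => lim (cesaro u @ G))).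
- move=> u v a bu bv; apply: cvg_lim => //.
  have -> : cesaro (fun n => u n + a * v n) = (fun n => cesaro u n + a * cesaro v n).
    by apply/funext => n; rewrite /cesaro big_split /= -mulr_sumr mulrDl mulrA.
  by apply: cvgD; [exact: cv|apply: cvgMr; exact: cv].
- move=> u bu u0; apply: limr_ge; first exact: cv.
  by apply: filterE => n; rewrite /cesaro divr_ge0 // sumr_ge0.
- apply: Glim; apply: cvg_near_cst; near=> n.
  rewrite /cesaro sumr_const card_ord divff // pnatr_eq0 -lt0n.
  by near: n; exists 1%N.
- move=> u bu; have bu' : seq_bounded (fun n => u n.+1).
    by have [B hB] := bu; exists B.
  apply/eqP; rewrite -subr_eq0; apply/eqP.
  rewrite -(@limB R R^o nat G _ _ _ (cv _ bu') (cv _ bu)).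
  apply: cvg_lim => //.
  have -> : cesaro (fun n => u n.+1) - cesaro u = (fun n => (u n - u 0%N) / n%:R).
    apply/funext => n; rewrite !fctE /cesaro -mulrBl; congr (_ / _).
    have := @big_ord_recl R 0 +%R n u; rewrite big_ord_recr /= => h.
    by apply/eqP; rewrite subr_eq addrAC -subr_eq opprK addrC h addrC.
  have [B hB] := bu.
  have h0 : (fun n : nat => (u n - u 0%N) / n%:R) @ \oo --> (0 : R).
    apply/cvgr0Pnorm_le => e e0; near=> n.
    have n0 : (0 < n)%N by near: n; exists 1%N.
    rewrite normrM normfV normr_nat ler_pdivrMr ?ltr0n //.
    apply: le_trans (ler_normB _ _) _; apply: le_trans (lerD (hB _) (hB _)) _.
    rewrite -ler_pdivrMl //; near: n; exact: nbhs_infty_ger.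
  by apply: cvg_trans h0; exact: cvg_app.
Unshelve. all: by end_near. Qed.

End Mean.

Section MeanTheory.
Variables (R : realType) (M : mean R).
Implicit Types (u v : nat -> R) (f g : nat -> circle R).

Lemma seq_bounded_cst (a : R) : seq_bounded (fun=> a).
Proof. by exists `|a|. Qed.

Lemma seq_boundedD u v a : seq_bounded u -> seq_bounded v ->
  seq_bounded (fun n => u n + a * v n).
Proof.
move=> [B hB] [C hC]; exists (B + `|a| * C) => n.
apply: le_trans (ler_normD _ _) _; rewrite normrM.
by apply: lerD => //; apply: ler_wpM2l.
Qed.

Lemma seq_boundedM u v : seq_bounded u -> seq_bounded v ->
  seq_bounded (fun n => u n * v n).
Proof.
move=> [B hB] [C hC]; exists (B * C) => n.
by rewrite normrM ler_pM.
Qed.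

Lemma seq_boundedZ a u : seq_bounded u -> seq_bounded (fun n => a * u n).
Proof. exact: (seq_boundedM (seq_bounded_cst a)). Qed.

Lemma seq_bounded_sqr u : seq_bounded u -> seq_bounded (fun n => u n ^+ 2).
Proof. by move=> bu; have := seq_boundedM bu bu; under eq_fun do rewrite -expr2. Qed.

Lemma seq_bounded_sum (I : Type) (r : seq I) (P : pred I) (F : I -> nat -> R) :
  (forall i, seq_bounded (F i)) -> seq_bounded (fun n => \sum_(i <- r | P i) F i n).
Proof.
move=> bF; have [B hB] := choice bF; exists (\sum_(i <- r | P i) B i) => n.
by apply: le_trans (ler_norm_sum _ _ _) _; apply: ler_sum.
Qed.

Lemma seq_bounded_cosc f : seq_bounded (fun n => cosc (f n)).
Proof. by exists 1 => n; exact: cosc_max. Qed.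

Lemma seq_bounded_sinc f : seq_bounded (fun n => sinc (f n)).
Proof. by exists 1 => n; exact: sinc_max. Qed.

Lemma meanD u v : seq_bounded u -> seq_bounded v ->
  M (fun n => u n + v n) = M u + M v.
Proof.
move=> bu bv; rewrite -[M v]mul1r -mean_linear //; congr (M _).
by apply/funext => n; rewrite mul1r.
Qed.

Lemma mean0 : M (fun=> 0) = 0.
Proof.
have b0 := seq_bounded_cst 0.
have := meanD b0 b0; rewrite (_ : (fun=> 0 + 0) = (fun=> 0)); last first.
  by apply/funext => n; rewrite addr0.
by move/eqP; rewrite -subr_eq0 opprD addNKr oppr_eq0 => /eqP.
Qed.

Lemma meanZ a u : seq_bounded u -> M (fun n => a * u n) = a * M u.
Proof.
move=> bu; rewrite -[RHS]add0r -mean0 -mean_linear //; last exact: seq_bounded_cst.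
by congr (M _); apply/funext => n; rewrite add0r.
Qed.

Lemma mean_cst a : M (fun=> a) = a.
Proof.
rewrite -[RHS]mulr1 -(mean_one M) -meanZ; last exact: seq_bounded_cst.
by congr (M _); apply/funext => n; rewrite mulr1.
Qed.

Lemma mean_sum (I : Type) (r : seq I) (P : pred I) (F : I -> nat -> R) :
  (forall i, seq_bounded (F i)) ->
  M (fun n => \sum_(i <- r | P i) F i n) = \sum_(i <- r | P i) M (F i).
Proof.
move=> bF; elim: r => [|i r IHr].
  by rewrite big_nil -[RHS]mean0; congr (M _); apply/funext => n; rewrite big_nil.
rewrite big_cons -IHr; case: ifP => Pi.
  rewrite -meanD //; last exact: seq_bounded_sum.
  by congr (M _); apply/funext => n; rewrite big_cons Pi.
by congr (M _); apply/funext => n; rewrite big_cons Pi.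
Qed.

Lemma mean_le u v : seq_bounded u -> seq_bounded v -> (forall n, u n <= v n) ->
  M u <= M v.
Proof.
move=> bu bv uv; rewrite -subr_ge0 -mulN1r -mean_linear //.
apply: mean_ge0 => [|n]; first exact: seq_boundedD.
by rewrite mulN1r subr_ge0.
Qed.

(** Expansion of the mean of (u - M u)^2, which is nonnegative. *)
Lemma mean_sqr u : seq_bounded u -> M u ^+ 2 <= M (fun n => u n ^+ 2).
Proof.
move=> bu; have b2 := seq_bounded_sqr bu.
have bc := seq_bounded_cst (M u ^+ 2).
have h : 0 <= M (fun n => (u n ^+ 2 + (- (M u *+ 2)) * u n) + 1 * M u ^+ 2).
  apply: mean_ge0 => [|n]; first by apply: seq_boundedD => //; exact: seq_boundedD.
  have -> : u n ^+ 2 + - (M u *+ 2) * u n + 1 * M u ^+ 2 = (u n - M u) ^+ 2 by ring.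
  exact: sqr_ge0.
rewrite mean_linear // in h; last exact: seq_boundedD.
rewrite mean_linear // mean_cst in h.
by rewrite -subr_ge0; apply: le_trans h _; rewrite le_eqVlt; apply/orP; left; apply/eqP; ring.
Qed.

Lemma mean_shiftn u k : seq_bounded u -> M (fun n => u (n + k)%N) = M u.
Proof.
move=> bu; elim: k => [|k IHk].
  by congr (M _); apply/funext => n; rewrite addn0.
rewrite -IHk -(mean_shift M (u := fun n => u (n + k)%N)).
  by congr (M _); apply/funext => n; rewrite addnS.
by have [B hB] := bu; exists B.
Qed.

Lemma mean_cosc_le1 f : M (fun n => cosc (f n)) <= 1.
Proof.
rewrite -[leRHS]mean_cst; apply: mean_le => [||n].
- exact: seq_bounded_cosc.
- exact: seq_bounded_cst.
- by have := cosc_max (f n); rewrite ler_norml => /andP[].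
Qed.

(** Real form of |sum e(y_i)|^2; the imaginary parts cancel between (i, j) and (j, i). A common
    translation of the points disappears on the left. *)
Lemma cosc_sum_sqr (I : finType) (y : I -> circle R) :
  \sum_i \sum_j cosc (y i - y j) = (\sum_i cosc (y i)) ^+ 2 + (\sum_i sinc (y i)) ^+ 2.
Proof.
rewrite !expr2 !mulr_suml -big_split /=; apply: eq_bigr => i _.
rewrite !mulr_sumr -big_split /=; apply: eq_bigr => j _.
by rewrite coscB.
Qed.

(** Shift invariance replaces the sequence by its average over H consecutive shifts; then [mean_sqr]
    applies, and the square of the sines is added to complete a squared modulus. *)
Lemma van_der_corput f (H : nat) : (0 < H)%N ->
  M (fun n => cosc (f n)) ^+ 2 <=
  (\sum_(i < H) \sum_(j < H) M (fun n => cosc (f (n + i)%N - f (n + j)%N))) / H%:R ^+ 2.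
Proof.
move=> H0; have Hn0 : (H%:R : R) != 0 by rewrite pnatr_eq0 -lt0n.
set u := fun n => H%:R^-1 * \sum_(i < H) cosc (f (n + i)%N).
have bs : seq_bounded (fun n => \sum_(i < H) cosc (f (n + i)%N)).
  by apply: seq_bounded_sum => i; exact: (seq_bounded_cosc (fun n => f (n + i)%N)).
have -> : M (fun n => cosc (f n)) = M u.
  rewrite meanZ // mean_sum; last first.
    by move=> i; exact: (seq_bounded_cosc (fun n => f (n + i)%N)).
  under eq_bigr => i _ do
    rewrite (mean_shiftn (u := fun n => cosc (f n)) i (seq_bounded_cosc f)).
  by rewrite sumr_const card_ord -[X in _ * X]mulr_natl mulKf.
apply: le_trans (mean_sqr _) _.
  exact: seq_boundedZ.
under eq_bigr => i _.
  rewrite -mean_sum; last by move=> j; exact: seq_bounded_cosc.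
  over.
rewrite -mean_sum; last first.
  by move=> i; apply: seq_bounded_sum => j; exact: seq_bounded_cosc.
rewrite mulrC -meanZ; last first.
  by apply: seq_bounded_sum => i; apply: seq_bounded_sum => j; exact: seq_bounded_cosc.
apply: mean_le => [||n].
- exact/seq_bounded_sqr/seq_boundedZ.
- apply: seq_boundedZ.
  by apply: seq_bounded_sum => i; apply: seq_bounded_sum => j; exact: seq_bounded_cosc.
rewrite (cosc_sum_sqr (fun i : 'I_H => f (n + i)%N)) /u exprMn exprVn.
by rewrite ler_wpM2l ?invr_ge0 ?exprn_ge0 // lerDl sqr_ge0.
Qed.

End MeanTheory.

(** * Weyl's inequality in the limit *)

Section FiniteDifferences.
Variable V : zmodType.
Implicit Types f g : nat -> V.

Definition fdiff f n := f n.+1 - f n.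

Lemma fdiffn0 k : iter k fdiff (fun=> 0) = fun=> 0.
Proof.
elim: k => [//|k IHk]; rewrite iterS IHk; apply/funext => n.
by rewrite /fdiff subrr.
Qed.

Lemma fdiffnMn k f q : iter k fdiff (fun n => f n *+ q) = fun n => iter k fdiff f n *+ q.
Proof.
elim: k => [//|k IHk]; rewrite iterS IHk; apply/funext => n.
by rewrite /fdiff /= mulrnBl.
Qed.

Lemma fdiffnB k f g : iter k fdiff (fun n => f n - g n) =
  fun n => iter k fdiff f n - iter k fdiff g n.
Proof.
elim: k => [//|k IHk]; rewrite iterS IHk; apply/funext => n.
by rewrite /fdiff /= !opprD !opprK addrACA.
Qed.

Lemma fdiffn_shift k f j : iter k fdiff (fun n => f (n + j)%N) =
  fun n => iter k fdiff f (n + j)%N.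
Proof. by elim: k => [//|k IHk]; rewrite iterS IHk. Qed.

Lemma fdiffn_eq0 k m f : (k <= m)%N -> (forall n, iter k fdiff f n = 0) ->
  forall n, iter m fdiff f n = 0.
Proof.
move=> km f0 n; rewrite -(subnK km) iterD (_ : iter k fdiff f = fun=> 0) ?fdiffn0 //.
exact/funext.
Qed.

Lemma newton_forward f n s :
  f (n + s)%N = \sum_(i < s.+1) iter i fdiff f n *+ 'C(s, i).
Proof.
elim: s f n => [|s IHs] f n; first by rewrite big_ord1 addn0 bin0.
rewrite addnS -addSn IHs.
have h : f n + \sum_(i < s.+1) iter i.+1 fdiff f n *+ 'C(s, i.+1) =
    \sum_(i < s.+1) iter i fdiff f n *+ 'C(s, i).
  rewrite big_ord_recr /= bin_small // mulr0n addr0.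
  by rewrite [RHS]big_ord_recl bin0.
rewrite [RHS]big_ord_recl bin0 /= mulr1n.
under [X in _ = _ + X]eq_bigr => i _ do
  rewrite -[fdiff _ _]/(iter i.+1 fdiff f n) /bump /= add1n binS mulrnDr.
rewrite big_split /= addrA h -big_split /=; apply: eq_bigr => i _.
by rewrite -mulrnDl; congr (_ *+ _); rewrite /fdiff addrC subrK.
Qed.

(* Under [g (n + j) = g n], the difference [iter e.+1 fdiff g] is killed by [j], so
   [g *+ j] has degree one less. *)
Lemma periodic_fdiff e g j : (forall n, iter e.+1 fdiff g n = 0) ->
  (forall n, g (n + j)%N = g n) -> forall n, fdiff g n *+ j ^ e = 0.
Proof.
elim: e g => [|e IHe] g g0 gj n; first by rewrite expn0 mulr1n; exact: g0.
rewrite expnS mulrnA -/(fdiff (fun n => g n *+ j) n).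
have -> : fdiff g n *+ j = fdiff (fun n => g n *+ j) n by rewrite /fdiff mulrnBl.
apply: IHe => [m|m]; last by rewrite gj.
rewrite fdiffnMn; set h := iter e fdiff g.
have hj : h (m + j)%N = h m.
  have -> : h (m + j)%N = iter e fdiff (fun n => g (n + j)%N) m by rewrite fdiffn_shift.
  by rewrite (_ : (fun n => _) = g) //; exact/funext.
have h2 i : fdiff h (m + i)%N = fdiff h m.
  elim: i => [|i IHi]; first by rewrite addn0.
  by rewrite addnS -[RHS]IHi; apply/eqP; rewrite -subr_eq0; apply/eqP; exact: g0.
have hl i : h (m + i)%N = h m + fdiff h m *+ i.
  elim: i => [|i IHi]; first by rewrite addn0 addr0.
  rewrite mulrSr addrA -IHi -(h2 i) /fdiff addnS addrC subrK //.
move: (hl j); rewrite hj => /eqP; rewrite -subr_eq0 opprD addNKr oppr_eq0.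
by move=> /eqP.
Qed.

End FiniteDifferences.

Lemma leq_exp_base (m n k : nat) : (m <= n)%N -> (m ^ k <= n ^ k)%N.
Proof. by case: k => [//|k] mn; rewrite leq_exp2r. Qed.

(** From i C(n, i) = n C(n-1, i-1) with n = q m!, where i divides m!. It removes the terms of order
    at least 2 in Newton's expansion when [q] kills the second differences. *)
Lemma dvdn_bin_mul_fact (q m i : nat) : (0 < i <= m)%N -> (q %| 'C(q * m`!, i))%N.
Proof.
case: i => [//|i] /= im.
have h := mul_bin_diag (q * m`!) i.
have /dvdnP[k hk] : (i.+1 %| m`!)%N by apply: dvdn_fact.
rewrite -(@dvdn_pmul2l i.+1) //; apply/dvdnP; exists (k * 'C((q * m`!).-1, i))%N.
rewrite -h; move: 'C(_, _) => C; rewrite hk; move: (i.+1) => j; ring.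
Qed.

Section Weyl.
Variables (R : realType) (M : mean R).

(** In complex form, shifting by s multiplies the mean of e(f) by e(y); this mean is nonzero because
    its real part is positive, so e(y) = 1. *)
Lemma mean_rotation (f : nat -> circle R) (s : nat) (y : circle R) :
  (forall n, f (n + s)%N = f n + y) -> 0 < M (fun n => cosc (f n)) -> y = 0.
Proof.
move=> fs Mpos; apply: cosc_eq1.
have bc := seq_bounded_cosc f; have bs := seq_bounded_sinc f.
have e1 : M (fun n => cosc (f n)) =
    cosc y * M (fun n => cosc (f n)) + (- sinc y) * M (fun n => sinc (f n)).
  rewrite -{1}(mean_shiftn M s bc) -(meanZ M _ bc) -mean_linear //; last exact: seq_boundedZ.
  by congr (M _); apply/funext => n; rewrite fs coscD mulNr mulrC [X in _ - X]mulrC.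
have e2 : M (fun n => sinc (f n)) =
    cosc y * M (fun n => sinc (f n)) + sinc y * M (fun n => cosc (f n)).
  rewrite -{1}(mean_shiftn M s bs) -(meanZ M _ bs) -mean_linear //; last exact: seq_boundedZ.
  by congr (M _); apply/funext => n; rewrite fs sincD mulrC [X in _ + X]mulrC.
have e3 := cosc2Dsinc2 y.
set b := M (fun n => sinc (f n)) in e1 e2; set a := M _ in e1 e2 Mpos.
have : ((1 - cosc y) ^+ 2 + sinc y ^+ 2) * a = 0.
  have h1 : (1 - cosc y) * a + sinc y * b = 0.
    rewrite (_ : _ + _ = a - (cosc y * a + - sinc y * b)); last by ring.
    by rewrite -e1 subrr.
  have h2 : (1 - cosc y) * b - sinc y * a = 0.
    rewrite (_ : _ - _ = b - (cosc y * b + sinc y * a)); last by ring.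
    by rewrite -e2 subrr.
  transitivity ((1 - cosc y) * ((1 - cosc y) * a + sinc y * b)
     - sinc y * ((1 - cosc y) * b - sinc y * a)); first by ring.
  by rewrite h1 h2 !mulr0 subr0.
move/eqP; rewrite mulf_eq0 (gt_eqF Mpos) orbF => /eqP h.
by move: h e3; clear; move: (cosc y) (sinc y) => c s h e; lra.
Qed.

(* Functions with vanishing [D.+1]-st difference play the role of polynomials of
   degree at most [D]: no coefficients are needed, and [q * fdiff f = 0] says that
   all the nonconstant coefficients are rational with denominator dividing [q]. *)
Lemma weyl (D : nat) : exists c : nat, forall (E : nat) (f : nat -> circle R),
  (2 <= E)%N -> (forall n, iter D.+1 (@fdiff _) f n = 0) ->
  E%:R^-1 <= M (fun n => cosc (f n)) ->
  exists2 q : nat, (0 < q <= E ^ c)%N & forall n, fdiff f n *+ q = 0.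
Proof.
elim: D => [|D [c IH]].
  by exists 0%N => E f _ f0 _; exists 1%N.
exists (3 * c + 3 * D + (D.+1)`!)%N => E f E2 f0 hE.
have En0 : (E%:R : R) != 0 by rewrite pnatr_eq0; lia.
have Epos : 0 < (E%:R : R) by rewrite ltr0n; lia.
(* With this H the lower bound H^2 / E^2 for the double sum equals 2H. The diagonal contributes only
   H, so some off-diagonal mean is at least 1/H. *)
pose H := (2 * E ^ 2)%N.
have H0 : (0 < H)%N by rewrite /H; lia.
have Hpos : 0 < (H%:R : R) by rewrite ltr0n.
have [j [j0 jH] hj] : exists2 j : nat, (0 < j /\ j < H)%N &
    H%:R^-1 <= M (fun n => cosc (f (n + j)%N - f n)).
  have bcs (g : nat -> circle R) := seq_bounded_cosc g.
  apply: contrapT => hn.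
  have hsm (i j : 'I_H) : i != j -> M (fun n => cosc (f (n + i)%N - f (n + j)%N)) < H%:R^-1.
    move=> ij; rewrite ltNge; apply/negP => h; apply: hn.
    wlog ij' : i j ij h / (j < i)%N => [hw|].
      have [ji|] := ltnP j i; first exact: (hw i j).
      rewrite leq_eqVlt => /orP[/eqP /val_inj e|ij']; first by rewrite e eqxx in ij.
      apply: (hw j i) => //; first by rewrite eq_sym.
      apply: le_trans h _; rewrite le_eqVlt; apply/orP; left; apply/eqP; congr (M _).
      by apply/funext => n; rewrite -coscN opprB.
    exists (i - j)%N; first by have := ltn_ord i; lia.
    rewrite -(mean_shiftn M j (bcs _)) /=.
    apply: le_trans h _; rewrite le_eqVlt; apply/orP; left; apply/eqP; congr (M _).
    by apply/funext => n; rewrite -addnA subnKC // ltnW.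
  have := van_der_corput M f H0.
  rewrite leNgt => /negP; apply.
  apply: (@lt_le_trans _ _ (E%:R^-1 ^+ 2)); last first.
    by rewrite lerXn2r ?nnegrE ?invr_ge0 ?ler0n //; apply: le_trans hE; rewrite invr_ge0.
  rewrite ltr_pdivrMr ?exprn_gt0 //.
  have -> : E%:R^-1 ^+ 2 * H%:R ^+ 2 = \sum_(i < H) (2 : R).
    rewrite sumr_const card_ord -[RHS]mulr_natr /H natrM natrX.
    by field.
  apply: ltr_sum => [|i _]; first by apply/hasP; exists (Ordinal H0); rewrite ?mem_index_enum.
  rewrite (bigD1 i) //=.
  under [X in M X + _]eq_fun do rewrite subrr cosc0.
  rewrite mean_one.
  have -> : (2 : R) = 1 + \sum_(j < H) H%:R^-1.
    by rewrite sumr_const card_ord -[X in _ + X]mulr_natl divff ?lt0r_neq0.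
  rewrite ltrD2l [ltRHS](bigD1 i) //= -[ltLHS]add0r ltr_leD ?invr_gt0 //.
  by apply: ler_sum => k ki; apply/ltW/hsm; rewrite eq_sym.
have [|||q' /andP[q'0 q'le] hq'] := IH H (fun n => f (n + j)%N - f n).
- by rewrite /H; lia.
(* The order-zero term of Newton's expansion cancels, so f(n + j) - f(n) has degree one less. *)
- move=> n; rewrite fdiffnB fdiffn_shift.
  rewrite (newton_forward _ n j) big_ord_recl bin0 mulr1n addrAC subrr add0r.
  apply: big1 => i _; rewrite -iterD.
  by rewrite (@fdiffn_eq0 _ D.+2) ?mul0rn //= /bump; lia.
- exact: hj.
(* The sequence q' * fdiff f is j-periodic because q' kills the differences of f(n + j) - f(n); by
   [periodic_fdiff] a further factor j^D then kills the second differences of f. *)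
pose q := (q' * j ^ D)%N.
have q0 : (0 < q)%N by rewrite muln_gt0 q'0 expn_gt0 j0.
have hq n : iter 2 (@fdiff _) f n *+ q = 0.
  have e : iter 2 (@fdiff _) f n *+ q' = fdiff (fun n => fdiff f n *+ q') n.
    by rewrite /= [in RHS]/fdiff -mulrnBl.
  rewrite mulrnA e {e}; move: n; apply: periodic_fdiff => m.
    by rewrite fdiffnMn -iterSr f0 mul0rn.
  apply/eqP; rewrite -subr_eq0 -mulrnBl -[X in _ == X](hq' m); apply/eqP; congr (_ *+ _).
  by rewrite /fdiff addSn !opprB addrACA [RHS]addrACA [- f (m + j)%N + _]addrC.
(* The factorial makes [q] divide C(s, i) for 2 <= i <= D+1, so shifting f by s adds s * fdiff f,
   which is constant in n: a rotation, handled by [mean_rotation]. *)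
pose s := (q * (D.+1)`!)%N.
have hs n : f (n + s)%N = f n + fdiff f n *+ s.
  rewrite newton_forward big_ord_recl bin0 mulr1n; congr (_ + _).
  have s0 : (0 < s)%N by rewrite muln_gt0 q0 fact_gt0.
  rewrite -(prednK s0) big_ord_recl /= bin1 prednK // big1 ?addr0 // => i _.
  rewrite /bump /= !add1n.
  have [iD|iD] := ltnP i.+1 D.+1; last first.
    rewrite [X in X *+ _](_ : _ = 0) ?mul0rn //.
    exact: (@fdiffn_eq0 _ D.+2 i.+2).
  have /dvdnP[k ->] := @dvdn_bin_mul_fact q D.+1 i.+2 iD.
  have -> : fdiff (fdiff (iter i (@fdiff _) f)) n = iter i (@fdiff _) (iter 2 (@fdiff _) f) n.
    by rewrite -iterD addn2.
  rewrite mulnC mulrnA -[X in X *+ k]/((fun m => iter i (@fdiff _) _ m *+ q) n) -fdiffnMn.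
  by rewrite (_ : (fun n => _) = fun=> 0) ?fdiffn0 ?mul0rn //; apply/funext.
have hc n : fdiff f n *+ s = fdiff f 0%N *+ s.
  elim: n => [//|n <-]; apply/eqP; rewrite -subr_eq0 -mulrnBl.
  by rewrite mulrnA; have /= := hq n; rewrite {1}/fdiff => ->; rewrite mul0rn.
exists s; last first.
  move=> n; rewrite hc; apply: (@mean_rotation f s) => [m|]; first by rewrite hs hc.
  by apply: lt_le_trans hE; rewrite invr_gt0.
rewrite muln_gt0 q0 fact_gt0 andTb expnD.
have HE : (H <= E ^ 3)%N by rewrite expnS leq_pmul2r // expn_gt0; lia.
apply: leq_mul; last first.
  by apply: ltnW; apply: ltn_expl.
rewrite expnD; apply: leq_mul; rewrite expnM.
  by apply: leq_trans q'le _; rewrite leq_exp_base.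
by apply: leq_trans (_ : H ^ D <= _)%N; rewrite leq_exp_base // ltnW.
Qed.

End Weyl.

(** * Integer matrices acting on abelian groups *)

Section IntegerMatrices.

Lemma absz_det_le n (A : 'M[int]_n) (B : nat) :
  (forall i j, (absz (A i j) <= B)%N) -> (absz (\det A) <= n`! * B ^ n)%N.
Proof.
move=> hA; rewrite -lez_nat abszE.
apply: le_trans (ler_norm_sum _ _ _) _.
apply: (@le_trans _ _ (\sum_(s : {perm 'I_n}) (B ^ n)%:Z)); last first.
  by rewrite sumr_const card_Sn -mulr_natl natz -PoszM.
apply: ler_sum => s _; rewrite normrM normrX normrN1 expr1n mul1r normr_prod.
apply: (@le_trans _ _ (\prod_(i < n) B%:Z)).
  by apply: ler_prod => i _; rewrite normr_ge0 -abszE lez_nat hA.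
by rewrite prodr_const card_ord -[leRHS]natz natrX natz.
Qed.

(* Cramer's rule for a maximal nonsingular minor. *)
Lemma rowspace_int_bound m n (P : 'M[int]_(m, n)) (a : 'rV[int]_n) (B : nat) :
  (0 < B)%N -> (forall i j, (absz (P i j) <= B)%N) ->
  (map_mx (intr : int -> rat) a <= map_mx (intr : int -> rat) P)%MS ->
  exists2 r : nat, (0 < r <= m`! * B ^ m)%N & exists c : 'rV[int]_m, r%:Z *: a = c *m P.
Proof.
move=> B0 hP; set Pq := map_mx _ P => haP.
pose f := maxrankfun Pq.
pose P1 := rowsub f P.
have P1q : map_mx intr P1 = rowsub f Pq by rewrite map_mxsub.
have full : row_full (map_mx (intr : int -> rat) P1)^T.
  by rewrite /row_full mxrank_tr P1q; exact: maxrowsub_free.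
pose g := fullrankfun full.
pose S := colsub g P1.
have hS : \det S != 0.
  rewrite -(intr_eq0 rat) -det_map_mx -unitfE -[_ \is a _]/(_ \in unitmx) -unitmx_tr.
  have -> : (map_mx intr S)^T = rowsub g (map_mx (intr : int -> rat) P1)^T.
    by apply/matrixP => i j; rewrite !mxE.
  exact: fullrowsub_unit.
have [x hx] : exists x, map_mx (intr : int -> rat) a = x *m map_mx intr P1.
  by apply/submxP; rewrite P1q eq_maxrowsub.
pose c1 : 'rV[int]_(\rank Pq) := colsub g a *m \adj S.
have hc : \det S *: a = c1 *m P1.
  suff h : map_mx (intr : int -> rat) (\det S *: a) = map_mx intr (c1 *m P1).
    apply/matrixP => i j; apply: (@intr_inj rat).
    by have /matrixP/(_ i j) := h; rewrite [LHS]mxE [RHS]mxE.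
  have ex : colsub g (map_mx (intr : int -> rat) a) = x *m map_mx intr S.
    by rewrite hx -mulmx_colsub /S map_mxsub.
  rewrite map_mxZ map_mxM /c1 map_mxM map_mxsub ex map_mx_adj -!mulmxA.
  rewrite [map_mx _ S *m _]mulmxA mul_mx_adj mul_scalar_mx -scalemxAr -hx.
  by rewrite det_map_mx.
have rm : (\rank Pq <= m)%N by exact: rank_leq_row.
exists (absz (\det S)).
  rewrite absz_gt0 hS /=; apply: leq_trans (absz_det_le _) _ => [i j|].
    by rewrite /S /P1 !mxE; exact: hP.
  by rewrite leq_mul ?leq_pexp2l // leq_fact.
(* The factor [rowsub f 1%:M] pads the coefficients by zero outside the chosen rows; the sign turns
   the determinant into its absolute value. *)
exists ((Num.sg (\det S)) *: (c1 *m rowsub f 1%:M)).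
rewrite -scalemxAl -mulmxA mul_rowsub_mx mul1mx -/P1 -hc scalerA.
by rewrite abszE -normrEsg.
Qed.

End IntegerMatrices.

Section Dot.
Variable V : zmodType.

(** For [V] the circle, [dot u] is the phase of the character of the torus with frequency u. *)
Definition dot n (u : 'rV[int]_n) (x : 'cV[V]_n) : V := \sum_j x j 0 *~ u 0 j.

Lemma dotBr n (u : 'rV[int]_n) (x y : 'cV[V]_n) : dot u (x - y) = dot u x - dot u y.
Proof. by rewrite /dot -sumrB; apply: eq_bigr => j _; rewrite !mxE mulrzBl. Qed.

Lemma dotDl n (u v : 'rV[int]_n) (x : 'cV[V]_n) : dot (u + v) x = dot u x + dot v x.
Proof. by rewrite /dot -big_split; apply: eq_bigr => j _; rewrite mxE mulrzDr. Qed.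

Lemma dot0l n (x : 'cV[V]_n) : dot 0 x = 0.
Proof. by rewrite /dot big1 // => j _; rewrite mxE mulr0z. Qed.

Lemma dotZl n a (u : 'rV[int]_n) (x : 'cV[V]_n) : dot (a *: u) x = dot u x *~ a.
Proof. by rewrite /dot mulrz_suml; apply: eq_bigr => j _; rewrite mxE mulrC mulrzA. Qed.

Lemma dotNl n (u : 'rV[int]_n) (x : 'cV[V]_n) : dot (- u) x = - dot u x.
Proof. by rewrite -scaleN1r dotZl mulrN1z. Qed.

Lemma dot_suml n (I : Type) (r : seq I) (P : pred I) (u : I -> 'rV[int]_n) (x : 'cV[V]_n) :
  dot (\sum_(i <- r | P i) u i) x = \sum_(i <- r | P i) dot (u i) x.
Proof. by apply: (big_morph (fun u => dot u x)); [move=> a b; exact: dotDl|exact: dot0l]. Qed.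

Lemma dot_mulmx m n (u : 'rV[int]_m) (P : 'M[int]_(m, n)) (x : 'cV[V]_n) :
  dot (u *m P) x = \sum_i dot (row i P) x *~ u 0 i.
Proof. by rewrite mulmx_sum_row dot_suml; apply: eq_bigr => i _; rewrite dotZl. Qed.

Lemma dot_delta n (x : 'cV[V]_n) j : dot (delta_mx 0 j) x = x j 0.
Proof.
rewrite /dot (bigD1 j) //= mxE !eqxx mulr1z big1 ?addr0 // => i ij.
by rewrite mxE eqxx (negPf ij) mulr0z.
Qed.

(** In a group with torsion the system at n = 1, ..., D+1 cannot be solved, but the adjugate of the
    Vandermonde matrix isolates each coefficient times the determinant, which depends on D alone. *)
Lemma vandermonde_torsion (D : nat) : exists2 q : nat, (0 < q)%N &
  forall (c : nat -> V) (y : V),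
  (forall n, (1 <= n)%N -> \sum_(d < D.+1) c d *+ (n ^ d) = y) ->
  forall d, (1 <= d <= D)%N -> c d *+ q = 0.
Proof.
pose a : 'rV[int]_D.+1 := \row_j (j.+1)%:Z.
pose W := Vandermonde D.+1 a.
have W0 : \det W != 0.
  rewrite det_Vandermonde; apply/prodf_neq0 => i _; apply/prodf_neq0 => j ij.
  by rewrite !mxE subr_eq0 eqz_nat eqSS gtn_eqF.
exists (absz (\det W)); first by rewrite absz_gt0.
move=> c y hc d /andP[d1 dD].
(* Subtracting the constant [y] from the degree-zero coefficient makes the system
   homogeneous. *)
pose c' : 'cV[V]_D.+1 := \col_i (c i - if i == 0 then y else 0).
have hW n : dot (row n W^T) c' = 0.
  rewrite -[RHS](subrr y) -{1}(hc n.+1) // /dot.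
  have e (m i : nat) : (m%:Z ^+ i) = (m ^ i)%:Z by rewrite -natz -natrX natz.
  under eq_bigr => i _ do rewrite !mxE mulrzBl e.
  rewrite sumrB; congr (_ - _).
  by rewrite big_ord_recl /= expn0 mulr1z big1 ?addr0 // => i _; rewrite mul0rz.
have hd : (d < D.+1)%N by [].
have : dot (delta_mx 0 (Ordinal hd) *m (\adj W^T *m W^T)) c' = 0.
  by rewrite mulmxA dot_mulmx big1 // => i _; rewrite hW mul0rz.
rewrite mul_adj_mx det_tr mul_mx_scalar dotZl dot_delta mxE /=.
case: d d1 hd {dD} => [//|d] _ hd /=; rewrite subr0 => h.
have [e|e] := eqVneq (absz (\det W))%:Z (\det W).
  by rewrite -[RHS]h -{2}e.
have e' : (absz (\det W))%:Z = - \det W by move: e; lia.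
by rewrite -[_ *+ _]/(_ *~ (absz (\det W))%:Z) e' mulrNz h oppr0.
Qed.

End Dot.

Section Pigeonhole.

Lemma pigeonhole (I F : finType) (A : {set I}) (f : I -> F) : (0 < #|F|)%N ->
  exists y, (#|A| <= #|[set i in A | f i == y]| * #|F|)%N.
Proof.
move=> F0; have [y0 _] : exists y, y \in F by apply/card_gt0P.
have [y _ hy] := @arg_maxnP F y0 predT (fun y => #|[set i in A | f i == y]|) isT.
exists y; rewrite -sum1_card (partition_big f predT) //=.
rewrite mulnC -sum_nat_const; apply: leq_sum => z _.
apply: leq_trans (hy z isT); rewrite -sum1_card; apply: eq_leq.
by apply: eq_bigl => i; rewrite inE.
Qed.

End Pigeonhole.

(** * Missing a ball forces a large exponential sum *)

Section Fejer.
Variable R : realType.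

(* For [0 < n] this amounts to [torus_norm x <= eps]. *)
Definition coords_near n (eps : R) (x : torus R n) : Prop :=
  forall i, exists2 w, toc w = x i 0 & `|w| <= eps.

Lemma dirichlet_sqr_le (t : circle R) (m : nat) :
  (\sum_(j < m) cosc (t *+ j)) ^+ 2 + (\sum_(j < m) sinc (t *+ j)) ^+ 2 <= m%:R ^+ 2.
Proof.
rewrite -(cosc_sum_sqr (fun j : 'I_m => t *+ j)).
apply: (@le_trans _ _ (\sum_(i < m) \sum_(j < m) 1)).
  apply: ler_sum => i _; apply: ler_sum => j _.
  by have := cosc_max (t *+ i - t *+ j); rewrite ler_norml => /andP[].
by rewrite !sumr_const card_ord expr2 mulr_natr.
Qed.

(** Geometric series: |1 - e(t)|^2 times the squared modulus of the sum is |1 - e(mt)|^2, and |1 -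
    e(t)|^2 = 2 (1 - cos t). *)
Lemma dirichlet_kernel_le (t : circle R) (m : nat) :
  ((\sum_(j < m) cosc (t *+ j)) ^+ 2 + (\sum_(j < m) sinc (t *+ j)) ^+ 2) * (1 - cosc t) <= 2.
Proof.
set A := \sum_(j < m) _; set B := \sum_(j < m) _.
have h1 : (1 - cosc t) * A + sinc t * B = 1 - cosc (t *+ m).
  rewrite /A /B; elim: m {A B} => [|m IHm].
    by rewrite !big_ord0 !mulr0 addr0 mulr0n cosc0 subrr.
  rewrite !big_ord_recr /= !mulrDr addrACA IHm mulrSr coscD; ring.
have h2 : (1 - cosc t) * B - sinc t * A = - sinc (t *+ m).
  rewrite /A /B; elim: m {A B h1} => [|m IHm].
    by rewrite !big_ord0 !mulr0 subr0 mulr0n sinc0 oppr0.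
  rewrite !big_ord_recr /= !mulrDr opprD addrACA IHm mulrSr sincD; ring.
have h3 := cosc2Dsinc2 t; have h4 := cosc2Dsinc2 (t *+ m).
have h5 : (A ^+ 2 + B ^+ 2) * (1 - cosc t) = 1 - cosc (t *+ m).
  apply: (@mulfI _ 2); first by rewrite pnatr_eq0.
  have e4 : sinc (t *+ m) ^+ 2 = 1 - cosc (t *+ m) ^+ 2.
    by apply/eqP; rewrite eq_sym subr_eq [X in _ == X]addrC h4.
  have e3 : sinc t ^+ 2 = 1 - cosc t ^+ 2.
    by apply/eqP; rewrite eq_sym subr_eq [X in _ == X]addrC h3.
  transitivity ((1 - cosc (t *+ m)) ^+ 2 + (- sinc (t *+ m)) ^+ 2); last first.
    by rewrite sqrrN e4; ring.
  rewrite -h1 -h2; transitivity (((1 - cosc t) ^+ 2 + sinc t ^+ 2) * (A ^+ 2 + B ^+ 2)).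
    by rewrite e3; ring.
  ring.
rewrite h5; have := cosc_max (t *+ m); rewrite ler_norml => /andP[]; lra.
Qed.

(* All sums [\sum_(l <- ls) j_l * e_l] with [0 <= j_l < M], with multiplicity: the
   frequencies in the expansion of a product of Dirichlet kernels. *)
Fixpoint grid L (M : nat) (ls : seq 'I_L) : seq 'rV[int]_L :=
  if ls is l :: ls' then
    [seq u + j%:Z *: delta_mx 0 l | u <- grid M ls', j <- iota 0 M]
  else [:: 0].

Lemma size_grid L M (ls : seq 'I_L) : size (grid M ls) = (M ^ size ls)%N.
Proof. by elim: ls => [//|l ls IH] /=; rewrite size_allpairs size_iota IH expnSr. Qed.

Lemma grid_bound L M (ls : seq 'I_L) u l : (0 < M)%N -> u \in grid M ls ->
  0 <= u 0 l <= (M.-1 * count_mem l ls)%:Z.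
Proof.
move=> M0; elim: ls u => [|l' ls IH] u /=; first by rewrite inE => /eqP->; rewrite mxE muln0.
move=> /allpairsP[[v j] /= [hv hj ->]].
rewrite mem_iota add0n in hj; have {IH hv} := IH _ hv; rewrite !mxE eqxx /= [l == l']eq_sym.
case: eqP => _ /=; rewrite ?mulr1 ?mulr0; nia.
Qed.

Lemma grid_power L M (ls : seq 'I_L) (x : torus R L) :
  (\sum_(u <- grid M ls) cosc (dot u x)) ^+ 2 + (\sum_(u <- grid M ls) sinc (dot u x)) ^+ 2 =
  \prod_(l <- ls) ((\sum_(j < M) cosc (x l 0 *+ j)) ^+ 2 + (\sum_(j < M) sinc (x l 0 *+ j)) ^+ 2).
Proof.
elim: ls => [|l ls IH] /=.
  by rewrite big_nil !big_seq1 dot0l cosc0 sinc0; ring.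
have hd (u : 'rV[int]_L) (j : nat) :
    dot (u + j%:Z *: delta_mx 0 l) x = dot u x + x l 0 *+ j.
  by rewrite dotDl dotZl dot_delta.
rewrite big_cons -IH !big_allpairs_dep.
under eq_bigr => u _ do under eq_bigr => j _ do rewrite hd coscD.
under [X in _ + X ^+ 2]eq_bigr => u _ do under eq_bigr => j _ do rewrite hd sincD.
under eq_bigr => u _ do rewrite sumrB -!mulr_sumr.
under [X in _ + X ^+ 2]eq_bigr => u _ do rewrite big_split /= -!mulr_sumr.
rewrite sumrB big_split /= -!mulr_suml -!(big_mkord predT (fun j => cosc (x l 0 *+ j))).
rewrite -!(big_mkord predT (fun j => sinc (x l 0 *+ j))) /index_iota subn0.
ring.
Qed.

(* Cauchy-Schwarz over the fibres of [phi]. *)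
Lemma collision_count (T : eqType) (B : finType) (s : seq T) (phi : T -> B) :
  (size s)%:R ^+ 2 <= #|B|%:R * \sum_(u <- s) \sum_(v <- s) (phi u == phi v)%:R :> R.
Proof.
pose c b : R := \sum_(u <- s) (phi u == b)%:R.
have e1 : \sum_b c b = (size s)%:R.
  rewrite exchange_big /=; under eq_bigr => u _.
    rewrite (bigD1 (phi u)) //= eqxx big1 ?addr0; last first.
      by move=> b; rewrite eq_sym => /negPf->.
    over.
  by rewrite big_const_seq count_predT iter_addr_0.
have e2 : \sum_b c b ^+ 2 = \sum_(u <- s) \sum_(v <- s) (phi u == phi v)%:R.
  under eq_bigr => b _ do rewrite expr2 mulr_suml.
  rewrite exchange_big /=; apply: eq_bigr => u _.
  under eq_bigr => b _ do rewrite mulr_sumr.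
  rewrite exchange_big /=; apply: eq_bigr => v _.
  rewrite (bigD1 (phi u)) //= eqxx mul1r [phi v == _]eq_sym big1 ?addr0 // => b.
  by rewrite eq_sym => /negPf->; rewrite mul0r.
rewrite -e2 -e1.
have [B0|B0] := posnP #|B|.
  rewrite big1 ?expr0n /= ?mulr_ge0 ?ler0n ?sumr_ge0 // => [b _|b _]; first exact: sqr_ge0.
  by have := card0_eq B0 b.
have Bpos : 0 < (#|B|%:R : R) by rewrite ltr0n.
set S := \sum_b c b.
have : 0 <= \sum_b (c b - S / #|B|%:R) ^+ 2 by apply: sumr_ge0 => b _; exact: sqr_ge0.
under eq_bigr => b _ do rewrite sqrrB.
rewrite big_split sumrB /= sumr_const sumrMnl -mulr_suml -/S.
rewrite -[_ *+ #|_|]mulr_natr => h.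
have := mulr_ge0 (ltW Bpos) h; move: (\sum_b c b ^+ 2) => X h'.
rewrite -subr_ge0; apply: le_trans h' _; rewrite le_eqVlt; apply/orP; left; apply/eqP.
by field; rewrite lt0r_neq0.
Qed.

(* The [L]-th power makes the decay in the one far coordinate beat the loss
   [M ^ L] from the number of frequencies. *)
Lemma fejer_bound L T M (x : torus R L) : (0 < L)%N -> (2 <= T)%N -> (0 < M)%N ->
  ~ coords_near T%:R^-1 x ->
  (\prod_(l < L) ((\sum_(j < M) cosc (x l 0 *+ j)) ^+ 2 +
                  (\sum_(j < M) sinc (x l 0 *+ j)) ^+ 2)) ^+ L
   <= (2 * T%:R ^+ 2 / M%:R ^+ 2) ^+ L * M%:R ^+ (2 * (L * L)).
Proof.
move=> L0 T2 M0 /existsNP[l hl].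
have Tpos : 0 < (T%:R : R) by rewrite ltr0n; lia.
have Mpos : 0 < (M%:R : R) by rewrite ltr0n.
have hT : T%:R^-1 <= 1 / 2 :> R by rewrite mul1r lef_pV2 ?posrE // ler_nat.
have := cosc_far _ hT hl; rewrite invr_gt0 => /(_ Tpos) hc.
rewrite mulnA exprM -exprMn; apply: lerXn2r; rewrite ?nnegrE.
- by apply: prodr_ge0 => i _; rewrite addr_ge0 ?sqr_ge0.
- by rewrite mulr_ge0 ?exprn_ge0 ?divr_ge0 ?mulr_ge0 ?exprn_ge0.
have -> : M%:R ^+ (2 * L) = M%:R ^+ 2 * (M%:R ^+ 2) ^+ L.-1 :> R.
  by rewrite exprM -{1}(prednK L0) exprS.
rewrite (bigD1 l) //= mulrA divfK ?expf_neq0 ?lt0r_neq0 //.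
apply: ler_pM.
- by rewrite addr_ge0 ?sqr_ge0.
- by apply: prodr_ge0 => i _; rewrite addr_ge0 ?sqr_ge0.
- have h := dirichlet_kernel_le (x l 0) M.
  set D := _ + _ in h *.
  have D0 : 0 <= D by rewrite /D addr_ge0 ?sqr_ge0.
  rewrite -ler_pdivrMr ?exprn_gt0 // -exprVn.
  by apply: le_trans h; rewrite ler_wpM2l.
- apply: (@le_trans _ _ (\prod_(i < L | i != l) (M%:R ^+ 2))).
    by apply: ler_prod => i _; rewrite addr_ge0 ?sqr_ge0 //= dirichlet_sqr_le.
  rewrite prodr_const; apply: le_trans (_ : _ <= (M%:R ^+ 2) ^+ L.-1) _; last by [].
  by rewrite cardC1 card_ord.
Qed.

(** If all nonzero frequencies had small sums, the kernel |sum of e(u . (y_i - s)) over u in G|^2,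
    summed over i, would be dominated by the coincidences u = v; but it is tiny since every y_i is
    far from s. The conclusion retains only differences, as s is not under control. *)
Lemma weyl_criterion L T k (y : 'I_k -> torus R L) (s : torus R L) :
  (0 < L)%N -> (2 <= T)%N -> (0 < k)%N ->
  (forall i, ~ coords_near T%:R^-1 (y i - s)) ->
  let K := (4 * T ^ 2 * L ^ 2)%N in
  exists u : 'rV[int]_L, [/\ u != 0, forall l, (absz (u 0%R l) < K)%N &
    (k%:R / (2 * K ^ L)%:R) ^+ 2 <= \sum_i \sum_j cosc (dot u (y i - y j))].
Proof.
move=> L0 T2 k0 hy K; apply: contrapT => hn.
(* Each axis occurs L times in [ls], so frequencies stay below M L = K. Also 2 T^2 / M^2 = 1 / (2K):
   the kernel is at most (2K)^-L of its trivial bound, while coincidences have proportion at least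
   K^-L. *)
pose M := (4 * T ^ 2 * L)%N.
have M0 : (0 < M)%N by rewrite /M; nia.
have K0 : (0 < K)%N by rewrite /K; nia.
have Mpos : 0 < (M%:R : R) by rewrite ltr0n.
have kpos : 0 < (k%:R : R) by rewrite ltr0n.
pose ls := flatten (nseq L (enum 'I_L)).
pose G := grid M ls.
pose eta : R := ((2 * K ^ L)%:R)^-1.
have eta0 : 0 < eta by rewrite invr_gt0 ltr0n muln_gt0 expn_gt0 K0.
have Gbound (u : 'rV[int]_L) l : u \in G -> 0 <= u 0 l < K%:Z.
  move=> uG; have := @grid_bound _ M ls u l M0 uG.
  have -> : count_mem l ls = L.
    by rewrite /ls count_flatten map_nseq sumn_nseq count_uniq_mem ?enum_uniq // mem_enum mul1n.
  have : (M.-1 * L < K)%N by rewrite /K /M; nia.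
  move: (M.-1 * L)%N (u 0 l) => a b aK /andP[b0 ba]; rewrite b0 /=.
  by apply: le_lt_trans ba _; rewrite ltz_nat.
have power i : (\sum_(u <- G) \sum_(v <- G) cosc (dot (u - v) (y i - s))) <= eta * (size G)%:R ^+ 2.
  have -> : \sum_(u <- G) \sum_(v <- G) cosc (dot (u - v) (y i - s)) =
    (\sum_(u <- G) cosc (dot u (y i - s))) ^+ 2 + (\sum_(u <- G) sinc (dot u (y i - s))) ^+ 2.
    rewrite !expr2 !mulr_suml -big_split /=; apply: eq_bigr => u _.
    rewrite !mulr_sumr -big_split /=; apply: eq_bigr => v _.
    by rewrite dotDl dotNl coscB.
  rewrite grid_power /ls big_flatten /= big_nseq iter_mulr_1 big_enum /=.
  apply: le_trans (fejer_bound L0 T2 M0 (hy i)) _.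
  rewrite size_grid /ls size_flatten /shape map_nseq sumn_nseq size_enum_ord.
  rewrite natrX -exprM [(2 * _)%N]mulnC ler_wpM2r ?exprn_ge0 //.
  have -> : 2 * T%:R ^+ 2 / M%:R ^+ 2 = (2 * K%:R)^-1 :> R.
    rewrite /K /M !natrM ?natrX; field.
    by rewrite !pnatr_eq0 -!lt0n; apply/andP; split; lia.
  rewrite /eta natrM natrX exprVn lef_pV2 ?posrE; last first.
  - by rewrite mulr_gt0 ?exprn_gt0 ?ltr0n.
  - by rewrite exprn_gt0 ?mulr_gt0 ?ltr0n.
  rewrite exprMn ler_pM2r ?exprn_gt0 ?ltr0n //.
  by rewrite -natrX ler_nat -{1}(expn1 2) leq_exp2l.
have small (u : 'rV[int]_L) : u != 0 -> (forall l, (absz (u 0%R l) < K)%N) ->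
    `|\sum_i cosc (dot u (y i - s))| <= k%:R * eta.
  move=> u0 uK; rewrite leNgt; apply/negP => h; apply: hn; exists u; split=> //.
  apply: (@le_trans _ _ (`|\sum_i cosc (dot u (y i - s))| ^+ 2)).
    by rewrite lerXn2r ?nnegrE ?mulr_ge0 // ?ltW.
  rewrite real_normK ?num_real //.
  have -> : \sum_i \sum_j cosc (dot u (y i - y j)) =
      \sum_i \sum_j cosc (dot u (y i - s) - dot u (y j - s)).
    apply: eq_bigr => i _; apply: eq_bigr => j _.
    by rewrite -dotBr opprB addrA subrK.
  by rewrite (cosc_sum_sqr (fun i => dot u (y i - s))) lerDl sqr_ge0.
pose phi (u : 'rV[int]_L) : {ffun 'I_L -> 'I_K} :=
  [ffun l => insubd (Ordinal K0) (absz (u 0%R l))].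
have phi_inj (u v : 'rV[int]_L) : u \in G -> v \in G -> (phi u == phi v) = (u == v).
  move=> uG vG; apply/eqP/eqP => [|->//] /ffunP h; apply/rowP => l.
  have := congr1 val (h l); rewrite !ffunE !val_insubd.
  have := Gbound u l uG; have := Gbound v l vG.
  move: (u 0%R l) (v 0%R l) => a b ha hb.
  have -> : (absz a < K)%N by lia.
  have -> : (absz b < K)%N by lia.
  lia.
pose dg : R := \sum_(u <- G) \sum_(v <- G) (u == v)%:R.
have dg_ge : 2 * eta * (size G)%:R ^+ 2 <= dg.
  have := collision_count G phi; rewrite card_ffun !card_ord => h.
  have -> : dg = \sum_(u <- G) \sum_(v <- G) (phi u == phi v)%:R.
    rewrite /dg !(big_seq_cond predT) /=; apply: eq_bigr => u /andP[uG _].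
    by rewrite !(big_seq_cond predT); apply: eq_bigr => v /andP[vG _]; rewrite phi_inj.
  have KL : 0 < ((K ^ L)%:R : R) by rewrite ltr0n expn_gt0 K0.
  have -> : 2 * eta = (K ^ L)%:R^-1 by rewrite /eta natrM invfM mulrA divff ?mul1r.
  by rewrite ler_pdivrMl.
have G0 : 0 < ((size G)%:R : R) by rewrite ltr0n size_grid expn_gt0 M0.
have tot : \sum_(u <- G) \sum_(v <- G) \sum_i cosc (dot (u - v) (y i - s)) <=
    k%:R * (eta * (size G)%:R ^+ 2).
  under eq_bigr => u _ do rewrite exchange_big /=.
  rewrite exchange_big /=.
  apply: (@le_trans _ _ (\sum_(i < k) (eta * (size G)%:R ^+ 2))); first by apply: ler_sum.
  by rewrite sumr_const card_ord -[leLHS]mulr_natl.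
have low : k%:R * dg - k%:R * eta * ((size G)%:R ^+ 2 - dg) <=
    \sum_(u <- G) \sum_(v <- G) \sum_i cosc (dot (u - v) (y i - s)).
  have -> : k%:R * dg - k%:R * eta * ((size G)%:R ^+ 2 - dg) =
    \sum_(u <- G) \sum_(v <- G) (k%:R * (u == v)%:R - k%:R * eta * (1 - (u == v)%:R)).
    under eq_bigr => u _ do rewrite sumrB -!mulr_sumr sumrB.
    rewrite sumrB -!mulr_sumr sumrB; congr (_ - _ * (_ - _)).
    by rewrite !big_const_seq !count_predT !iter_addr_0 -mulrnA natrM expr2.
  rewrite !big_seq; apply: ler_sum => u uG; rewrite !big_seq; apply: ler_sum => v vG.
  have [->|uv] := eqVneq u v.
    rewrite mulr1 [1 - _]subrr mulr0 subr0.
    under eq_bigr => i _ do rewrite subrr dot0l cosc0.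
    by rewrite sumr_const card_ord.
  rewrite mulr0 sub0r subr0 mulr1.
  have := small (u - v); rewrite subr_eq0 => /(_ uv).
  have h l : (absz ((u - v)%R 0%R l) < K)%N.
    have := Gbound u l uG; have := Gbound v l vG; rewrite !mxE.
    by move: (u 0 l) (v 0 l) => a b; lia.
  by move=> /(_ h); rewrite ler_norml => /andP[].
(* The diagonal gives at least 2 k eta |G|^2 and the rest loses at most k eta (|G|^2 - dg), which
   leaves strictly more than the upper bound k eta |G|^2. *)
have := le_trans low tot.
have e1 : 0 < k%:R * eta * (size G)%:R ^+ 2 by rewrite !mulr_gt0 ?exprn_gt0.
have e2 : k%:R * (2 * eta * (size G)%:R ^+ 2) <= k%:R * dg by rewrite ler_pM2l.
have e3 : 0 < k%:R * eta * dg.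
  rewrite !mulr_gt0 //; apply: lt_le_trans dg_ge; rewrite !mulr_gt0 ?exprn_gt0 //.
move: e1 e2 e3; clear; move: (k%:R) ((size G)%:R) => a b; lra.
Qed.

End Fejer.

(** * One bounded linear relation *)

Section PolynomialBounds.

(** With T >= 2 every constant is at most a power of T, so an exponent alone suffices. *)
Definition poly_bounded (X : nat -> nat) := exists c, forall T, (2 <= T)%N -> (X T <= T ^ c)%N.

Lemma poly_bounded_cst a : poly_bounded (fun=> a).
Proof. by exists a => T T2; apply: ltnW; apply: ltn_expl. Qed.

Lemma poly_bounded_id : poly_bounded id.
Proof. by exists 1%N => T; rewrite expn1. Qed.

Lemma poly_boundedM X Y : poly_bounded X -> poly_bounded Y ->
  poly_bounded (fun T => X T * Y T)%N.
Proof.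
by move=> [c hX] [d hY]; exists (c + d)%N => T T2; rewrite expnD leq_mul ?hX ?hY.
Qed.

Lemma poly_boundedD X Y : poly_bounded X -> poly_bounded Y ->
  poly_bounded (fun T => X T + Y T)%N.
Proof.
move=> [c hX] [d hY]; exists (c + d).+1 => T T2.
have h1 : (T ^ c <= T ^ (c + d))%N by rewrite leq_pexp2l ?leq_addr //; lia.
have h2 : (T ^ d <= T ^ (c + d))%N by rewrite leq_pexp2l ?leq_addl //; lia.
rewrite expnS; apply: leq_trans (_ : 2 * T ^ (c + d) <= _)%N; last by rewrite leq_mul.
by have := hX T T2; have := hY T T2; lia.
Qed.

Lemma poly_boundedX X m : poly_bounded X -> poly_bounded (fun T => X T ^ m)%N.
Proof.
move=> [c hX]; exists (c * m)%N => T T2.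
by rewrite expnM leq_exp_base ?hX.
Qed.

Lemma poly_bounded_comp X Y : poly_bounded X -> poly_bounded Y ->
  (forall T, (2 <= T)%N -> (2 <= Y T)%N) -> poly_bounded (fun T => X (Y T)).
Proof.
move=> [c hX] [d hY] Y2; exists (d * c)%N => T T2.
by apply: leq_trans (hX _ (Y2 _ T2)) _; rewrite expnM leq_exp_base ?hY.
Qed.

End PolynomialBounds.

Section PolynomialDifferences.
Variable V : zmodType.

Lemma fdiffnD k (f g : nat -> V) : iter k (@fdiff V) (fun n => f n + g n) =
  fun n => iter k (@fdiff V) f n + iter k (@fdiff V) g n.
Proof.
elim: k => [//|k IHk]; rewrite iterS IHk; apply/funext => n.
by rewrite /fdiff /= opprD addrACA.
Qed.

(** Discrete Leibniz rule. The offset [a] is a parameter because differencing turns it into a +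
    1. *)
Lemma fdiffn_mul_linear k a (f : nat -> V) : (forall n, iter k (@fdiff V) f n = 0) ->
  forall n, iter k.+1 (@fdiff V) (fun n => f n *+ (n + a)) n = 0.
Proof.
elim: k a f => [|k IHk] a f f0 n.
  have f0' m : f m = 0 by exact: f0.
  by rewrite /= /fdiff !f0' !mul0rn subrr.
rewrite iterSr (_ : fdiff _ = fun n => fdiff f n *+ (n + a.+1) + f n); last first.
  apply/funext => m; rewrite /fdiff mulrnBl addnS addSn -addrA; congr (_ + _).
  by rewrite mulrSr opprD -addrA addNr addr0.
rewrite fdiffnD f0 addr0 IHk // => m.
by rewrite -iterSr.
Qed.

Lemma fdiffn_polynomial (D : nat) (c : nat -> V) n :
  iter D.+1 (@fdiff V) (fun n => \sum_(d < D.+1) c d *+ (n.+1 ^ d)) n = 0.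
Proof.
have mono d (a : V) m : iter d.+1 (@fdiff V) (fun n => a *+ (n.+1 ^ d)) m = 0.
  elim: d m => [|d IHd] m.
    by rewrite /= /fdiff !expn0 subrr.
  rewrite (_ : (fun n => _) = (fun n => a *+ (n.+1 ^ d) *+ (n + 1))).
    by apply: fdiffn_mul_linear.
  by apply/funext => j; rewrite -mulrnA expnSr addn1.
have sums (r : seq 'I_D.+1) m :
    iter D.+1 (@fdiff V) (fun n => \sum_(d <- r) c d *+ (n.+1 ^ d)) m = 0.
  elim: r => [|d r IHr].
    by under [X in iter _ _ X]eq_fun do rewrite big_nil; rewrite fdiffn0.
  under [X in iter _ _ X]eq_fun do rewrite big_cons.
  by rewrite fdiffnD IHr addr0 (@fdiffn_eq0 _ d.+1).
exact: sums.
Qed.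

End PolynomialDifferences.

Lemma sum_ge_exists (R : realType) (I : finType) (P : pred I) (F : I -> R) (a : R) :
  0 < a -> (0 < #|I|)%N -> a * #|I|%:R <= \sum_(i | P i) F i ->
  exists2 i, P i & a <= F i.
Proof.
move=> a0 I0 h; apply: contrapT => hn.
have [i0 _] : exists i, i \in I by apply/card_gt0P.
move: h; rewrite leNgt => /negP; apply.
rewrite big_mkcond /= mulr_natr -sumr_const; apply: ltr_sum => [|i _].
  by apply/hasP; exists i0; rewrite ?mem_index_enum.
case: ifP => // Pi; rewrite ltNge; apply/negP => h; apply: hn; by exists i.
Qed.

Section Core.
Variable R : realType.

Definition evalA L N D (A : nat -> 'M[int]_(L, N)) (n : nat) : 'M[int]_(L, N) :=
  \sum_(d < D.+1) (n ^ d)%:Z *: A d.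

(* Hypothesis (b) of the theorem. *)
Definition cond_b L N D (A : nat -> 'M[int]_(L, N)) : Prop :=
  forall (v : 'rV[rat]_L) (w : 'cV[rat]_N),
    (forall d, (1 <= d <= D)%N -> v *m map_mx intr (A d) *m w = 0) ->
    v *m map_mx intr (A 0%N) *m w = 0.

Lemma torus_mulE m n (P : 'M[int]_(m, n)) (x : torus R n) i :
  torus_mul P x i 0 = dot (row i P) x.
Proof. by rewrite mxE; apply: eq_bigr => j _; rewrite mxE. Qed.

Lemma dot_torus_mul m n (u : 'rV[int]_m) (P : 'M[int]_(m, n)) (x : torus R n) :
  dot u (torus_mul P x) = dot (u *m P) x.
Proof. by rewrite dot_mulmx; apply: eq_bigr => i _; rewrite torus_mulE. Qed.

Lemma torus_mulB m n (P : 'M[int]_(m, n)) (x y : torus R n) :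
  torus_mul P (x - y) = torus_mul P x - torus_mul P y.
Proof. by apply/colP => i; rewrite torus_mulE dotBr -!torus_mulE !mxE. Qed.

Lemma dot_evalA L N D (A : nat -> 'M[int]_(L, N)) (u : 'rV[int]_L) n (x : torus R N) :
  dot (u *m evalA D A n) x = \sum_(d < D.+1) dot (u *m A d) x *+ (n ^ d).
Proof.
rewrite /evalA mulmx_sumr dot_suml; apply: eq_bigr => d _.
by rewrite -scalemxAr dotZl.
Qed.

(** Successive averaging fixes first the frequency, then a base point [i0], then the many i
    correlated with it; Weyl's inequality applies to each such pair. *)
Lemma weyl_sums_large L N D : (0 < L)%N -> exists2 X, poly_bounded X &
  forall T (A : nat -> 'M[int]_(L, N)) k (x : 'I_k -> torus R N),
  (2 <= T)%N -> (0 < k)%N ->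
  (forall n, (1 <= n)%N -> exists s, forall i,
     ~ coords_near T%:R^-1 (torus_mul (evalA D A n) (x i) - s)) ->
  exists (u : 'rV[int]_L) (I : {set 'I_k}) (i0 : 'I_k) (q : nat),
    [/\ u != 0, forall l, (absz (u 0%R l) <= X T)%N, (0 < q <= X T)%N, (k <= #|I| * X T)%N &
    forall i, i \in I -> forall n, (1 <= n)%N ->
      dot (u *m evalA D A n.+1) (x i0 - x i) *+ q = dot (u *m evalA D A n) (x i0 - x i) *+ q].
Proof.
move=> L0.
have [M _] := @mean_exists R.
have [c0 hc0] := weyl M D.
pose K T := (4 * T ^ 2 * L ^ 2)%N.
(* Chosen so that the mean over the frequency box and over all pairs is at least 2/E. Pairs below
   1/E account for at most half of this, so a proportion 1/E of the points reaches 1/E. *)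
pose E T := (2 * (2 * K T) ^ L * (2 * K T ^ L) ^ 2)%N.
have pK : poly_bounded K.
  by repeat (apply: poly_boundedM || apply: poly_boundedX || apply: poly_bounded_cst ||
             apply: poly_bounded_id).
have pE : poly_bounded E.
  by repeat (exact: pK || apply: poly_boundedM || apply: poly_boundedX || apply: poly_bounded_cst).
exists (fun T => K T + (E T ^ c0).+1 * E T)%N.
  apply: poly_boundedD => //; apply: poly_boundedM => //.
  under eq_fun do rewrite -addn1.
  by apply: poly_boundedD; [exact: poly_boundedX|exact: poly_bounded_cst].
move=> T A k x T2 k0 hx.
have K0 : (0 < K T)%N by rewrite /K; nia.
have KL1 : (0 < (2 * K T) ^ L)%N by rewrite expn_gt0 muln_gt0 K0.
have KL2 : (0 < 2 * K T ^ L)%N by rewrite muln_gt0 expn_gt0 K0.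
have E2 : (2 <= E T)%N by rewrite /E -mulnA leq_pmulr // muln_gt0 KL1 expn_gt0 KL2.
have Epos : 0 < ((E T)%:R : R) by rewrite ltr0n; lia.
have kpos : 0 < (k%:R : R) by rewrite ltr0n.
pose B := {ffun 'I_L -> 'I_(2 * K T)}.
pose dec (b : B) : 'rV[int]_L := \row_l ((b l)%:Z - (K T)%:Z).
pose f (b : B) i j n := dot (dec b *m evalA D A n.+1) (x i - x j).
have cardB : #|B| = ((2 * K T) ^ L)%N by rewrite card_ffun !card_ord.
have B0 : (0 < #|B|)%N by rewrite cardB expn_gt0 muln_gt0 K0.
have sumB n : (k%:R / (2 * K T ^ L)%:R) ^+ 2 <=
    \sum_(b : B | dec b != 0) \sum_i \sum_j cosc (f b i j n).
  have [s hs] := hx n.+1 isT.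
  have [u [u0 uK hu]] := weyl_criterion L0 T2 k0 hs.
  have hb l : (absz (u 0 l + (K T)%:Z)%R < 2 * K T)%N.
    by have := uK l; rewrite -/(K T); move: (u 0 l) => a; lia.
  pose b : B := [ffun l => Ordinal (hb l)].
  have db : dec b = u.
    apply/rowP => l; rewrite mxE ffunE /=.
    by have := uK l; rewrite -/(K T); move: (u 0 l) => a; lia.
  (* The other frequencies contribute squared moduli, so including them keeps the bound and makes it
     independent of the frequency serving this n. *)
  rewrite (bigD1 b) ?db //= -[leLHS]addr0; apply: lerD.
    apply: le_trans hu _; rewrite le_eqVlt; apply/orP; left; apply/eqP.
    apply: eq_bigr => i _; apply: eq_bigr => j _.
    by rewrite /f db -torus_mulB dot_torus_mul.
  apply: sumr_ge0 => b' _.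
  rewrite (_ : \sum_i _ = \sum_i \sum_j cosc (dot (dec b' *m evalA D A n.+1) (x i) -
                                              dot (dec b' *m evalA D A n.+1) (x j))).
    by rewrite (cosc_sum_sqr (fun i => dot (dec b' *m evalA D A n.+1) (x i))) addr_ge0 ?sqr_ge0.
  by apply: eq_bigr => i _; apply: eq_bigr => j _; rewrite /f dotBr.
have meanB : (k%:R / (2 * K T ^ L)%:R) ^+ 2 <=
    \sum_(b : B | dec b != 0) \sum_i \sum_j M (fun n => cosc (f b i j n)).
  have bd b i j : seq_bounded (fun n => cosc (f b i j n)) by exact: seq_bounded_cosc.
  have bd2 b i : seq_bounded (fun n => \sum_j cosc (f b i j n)) by exact: seq_bounded_sum.
  have bd3 b : seq_bounded (fun n => \sum_i \sum_j cosc (f b i j n)) by exact: seq_bounded_sum.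
  under eq_bigr => b _.
    under eq_bigr => i _ do rewrite -mean_sum //.
    rewrite -mean_sum //; over.
  rewrite -mean_sum // -[leLHS](mean_cst M); apply: mean_le => //.
  - exact: seq_bounded_cst.
  - exact: seq_bounded_sum.
have eK : (k%:R / (2 * K T ^ L)%:R) ^+ 2 = (2 * k%:R / (E T)%:R * k%:R) * #|B|%:R :> R.
  rewrite cardB /E !natrM ?natrX; field.
  by rewrite -!natrX !pnatr_eq0 -!lt0n KL1 expn_gt0 K0.
have [b bn0] : exists2 b : B, dec b != 0 &
    2 * k%:R / (E T)%:R * k%:R <= \sum_i \sum_j M (fun n => cosc (f b i j n)).
  apply: sum_ge_exists => //; last by rewrite -eK.
  by rewrite !mulr_gt0 ?invr_gt0.
rewrite -[X in _ * X%:R](card_ord k) => hsum.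
have [||i0 _ hi0] := sum_ge_exists _ _ hsum.
- by rewrite !mulr_gt0 ?invr_gt0.
- by rewrite card_ord.
pose J : {set 'I_k} := [set j | (E T)%:R^-1 <= M (fun n => cosc (f b i0 j n))]%SET.
have hJ : (k <= #|J| * E T)%N.
  have h : 2 * k%:R / (E T)%:R <= #|J|%:R + k%:R / (E T)%:R :> R.
    apply: le_trans hi0 _; rewrite (bigID (mem J)) /=; apply: lerD.
      apply: (@le_trans _ _ (\sum_(j in J) (1 : R))); last by rewrite sumr_const.
      by apply: ler_sum => j _; exact: mean_cosc_le1.
    apply: (@le_trans _ _ (\sum_(j < k) ((E T)%:R^-1 : R))); last first.
      by rewrite sumr_const card_ord -[leLHS]mulr_natl.
    rewrite [leRHS](bigID (mem J)) /= -[leLHS]add0r; apply: lerD.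
      by apply: sumr_ge0 => j _; rewrite invr_ge0 ltW.
    apply: ler_sum => j jJ; have {jJ} : j \notin J by exact: jJ.
    by rewrite /J inE -ltNge => /ltW.
  rewrite -(ler_nat R) natrM -ler_pdivrMr //.
  by move: h; rewrite -mulrA; lra.
have Hq (j : 'I_k) : exists q, j \in J ->
    (0 < q <= E T ^ c0)%N /\ forall n, fdiff (f b i0 j) n *+ q = 0.
  have [jJ|] := pselect (j \in J); last by exists 0%N.
  rewrite /J inE in jJ.
  have hf n : iter D.+1 (@fdiff _) (f b i0 j) n = 0.
    rewrite (_ : f b i0 j = fun n => \sum_(d < D.+1) dot (dec b *m A d) (x i0 - x j) *+ (n.+1 ^ d)).
      exact: (@fdiffn_polynomial _ D (fun d => dot (dec b *m A d) (x i0 - x j))).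
    by apply/funext => m; rewrite /f dot_evalA.
  have [q' q1 q2] := hc0 _ _ E2 hf jJ.
  by exists q'.
have [q hq] := choice Hq.
(* The annihilating integer varies with the point; its most frequent value is kept. On [J] it is at
   most E^c0, so [inord] does not alter it. *)
have [|q0 hq0] := @pigeonhole _ 'I_(E T ^ c0).+1 J (fun j => inord (q j)).
  by rewrite card_ord.
rewrite card_ord in hq0.
set I := [set i in J | _] in hq0.
have hI i : i \in I -> [/\ (0 < q0 <= E T ^ c0)%N & forall n, fdiff (f b i0 i) n *+ q0 = 0].
  rewrite inE => /andP[iJ /eqP <-].
  have [/andP[h1 h2] h3] := hq i iJ.
  by rewrite inordK ?ltnS // h1 h2.
have I0 : (0 < #|I|)%N by move: hJ hq0; case: #|I| => // ; nia.
have [i1 i1I] : exists i, i \in I by apply/card_gt0P.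
exists (dec b), I, i0, q0; split=> //.
- move=> l; rewrite mxE; have := ltn_ord (b l).
  by move: (nat_of_ord _) => a; lia.
- have [/andP[h1 h2] _] := hI i1 i1I.
  rewrite h1 /=; nia.
- apply: leq_trans hJ _; apply: leq_trans (leq_mul hq0 (leqnn _)) _.
  by rewrite -mulnA leq_mul // leq_addl.
move=> i iI [//|n] _; have [_ h] := hI i iI.
by apply/eqP; rewrite -subr_eq0 -mulrnBl; apply/eqP; exact: h n.
Qed.

End Core.

Section Relation.
Variable R : realType.

Lemma absz_sum_le (I : finType) (F : I -> int) (B : nat) :
  (forall i, (absz (F i) <= B)%N) -> (absz (\sum_i F i)%R <= #|I| * B)%N.
Proof.
move=> hF; rewrite -lez_nat abszE; apply: le_trans (ler_norm_sum _ _ _) _.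
apply: (@le_trans _ _ (\sum_(i : I) B%:Z)).
  by apply: ler_sum => i _; rewrite -abszE lez_nat.
by rewrite sumr_const -mulr_natl natz -PoszM.
Qed.

(** [vandermonde_torsion] gives the degrees d >= 1. Since T does not control A_0, degree 0 uses
    [rowspace_int_bound], whose multiplier is bounded by the spanning rows and not by the row
    expressed. *)
Lemma rational_relation L N D : (0 < L)%N -> exists2 X, poly_bounded X &
  forall T (A : nat -> 'M[int]_(L, N)) k (x : 'I_k -> torus R N),
  (2 <= T)%N -> (0 < k)%N ->
  (forall d i j, (1 <= d <= D)%N -> (absz (A d i j) <= T)%N) -> cond_b D A ->
  (forall n, (1 <= n)%N -> exists s, forall i,
     ~ coords_near T%:R^-1 (torus_mul (evalA D A n) (x i) - s)) ->
  exists (v : 'rV[int]_L) (I : {set 'I_k}),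
    [/\ v != 0, forall l, (absz (v 0%R l) <= X T)%N, (k <= #|I| * X T)%N &
    forall i j, i \in I -> j \in I -> forall d, (d <= D)%N ->
      dot (v *m A d) (x i - x j) = 0].
Proof.
move=> L0; have [X0 pX0 hX0] := @weyl_sums_large R L N D L0.
have [V V0 hV] := @vandermonde_torsion (circle R) D.
pose U T := (X0 T * V * X0 T)%N.
pose B T := (L * (U T * T)).+1.
exists (fun T => X0 T + D`! * B T ^ D * U T)%N.
  have pU : poly_bounded U.
    by repeat (exact: pX0 || apply: poly_boundedM || apply: poly_bounded_cst).
  have pB : poly_bounded B.
    rewrite /B; under eq_fun do rewrite -addn1.
    by repeat (exact: pU || apply: poly_boundedM || apply: poly_boundedD ||
               apply: poly_bounded_cst || apply: poly_bounded_id).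
  by repeat (exact: pU || exact: pB || exact: pX0 || apply: poly_boundedM ||
             apply: poly_boundedD || apply: poly_boundedX || apply: poly_bounded_cst).
move=> T A k x T2 k0 hA hb hx.
have [u [I [i0 [q [u0 hu /andP[q0 hq] hk hI]]]]] := hX0 T A k x T2 k0 hx.
pose v1 : 'rV[int]_L := (q * V)%:Z *: u.
have v1_bound l : (absz (v1 0%R l) <= U T)%N.
  rewrite mxE abszM absz_nat /U; apply: leq_mul (hu l).
  by rewrite leq_mul2r hq orbT.
have rel1 i d : i \in I -> (1 <= d <= D)%N -> dot (v1 *m A d) (x i0 - x i) = 0.
  move=> iI dD; rewrite -scalemxAl dotZl -[LHS]/(_ *+ (q * V)) mulrnA.
  apply: (hV (fun d => dot (u *m A d) (x i0 - x i) *+ q)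
    (dot (u *m evalA D A 1) (x i0 - x i) *+ q)) => // n n1.
  transitivity (dot (u *m evalA D A n) (x i0 - x i) *+ q).
    by rewrite dot_evalA -sumrMnl; apply: eq_bigr => e _; rewrite mulrnAC.
  by case: n n1 => [//|n] _; elim: n => [//|n IHn]; rewrite hI.
pose P : 'M[int]_(D, N) := \matrix_(e, j) (v1 *m A e.+1) 0 j.
have rowP (e : 'I_D) : row e P = v1 *m A e.+1 by apply/rowP => j; rewrite !mxE.
have P_bound e j : (absz (P e j) <= B T)%N.
  rewrite mxE mxE; apply: leqW.
  apply: leq_trans (absz_sum_le (B := U T * T) _) _; last by rewrite card_ord.
  by move=> l; rewrite abszM leq_mul // hA //=; have := ltn_ord e.
(* A row lies in a row space iff it annihilates the cokernel; the columns of the cokernel are the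
   vectors w to which (b) is applied. *)
have hsub : (map_mx (intr : int -> rat) (v1 *m A 0%N) <= map_mx (intr : int -> rat) P)%MS.
  rewrite submxE; apply/eqP/matrixP => i j; rewrite [RHS]mxE.
  set C := cokermx _.
  have hb' := hb (map_mx intr v1) (col j C); rewrite -map_mxM in hb'.
  suff e : map_mx (intr : int -> rat) (v1 *m A 0%N) *m col j C = 0.
    have /matrixP/(_ i 0) : col j (map_mx (intr : int -> rat) (v1 *m A 0%N) *m C) = 0.
      by rewrite colE -mulmxA -colE.
    by rewrite !mxE.
  apply: hb' => d /andP[d0 dD].
  have hd : (d.-1 < D)%N by rewrite prednK.
  rewrite -map_mxM -{1}(prednK d0) -[d.-1]/(val (Ordinal hd)) -rowP map_row.
  by rewrite rowE -mulmxA [col j C]colE [map_mx _ P *m (C *m _)]mulmxA mulmx_coker mul0mx mulmx0.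
have [r /andP[r0 hr] [c hc]] := rowspace_int_bound (ltn0Sn _) P_bound hsub.
have rel0 i : i \in I -> dot (v1 *m A 0%N) (x i0 - x i) *+ r = 0.
  move=> iI; rewrite -[_ *+ r]/(_ *~ r%:Z) -dotZl hc dot_mulmx big1 // => e _.
  by rewrite rowP rel1 ?mul0rz //=.
exists (r%:Z *: v1), I; split.
- by rewrite /v1 !scalemx_eq0 !negb_or u0 !eqz_nat -!lt0n r0 muln_gt0 q0 V0.
- move=> l; rewrite mxE abszM absz_nat; apply: leq_trans (leq_addl _ _).
  by rewrite leq_mul.
- by apply: leq_trans hk _; rewrite leq_mul // leq_addr.
have rel i d : i \in I -> (d <= D)%N -> dot (r%:Z *: v1 *m A d) (x i0 - x i) = 0.
  move=> iI dD; rewrite -scalemxAl dotZl; case: d dD => [_|d dD]; first exact: rel0.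
  by rewrite rel1 // mul0rz.
move=> i j iI jI d dD.
have -> : x i - x j = (x i0 - x j) - (x i0 - x i) by rewrite opprB [RHS]addrC addrA subrK.
by rewrite dotBr !rel // subrr.
Qed.

End Relation.

(** * Induction on the dimension of the target *)

Section Induction.
Variable R : realType.

(* [eps]-density in the coset [t + psi (T^r)].  Only subtori of this form occur in
   the induction, and they are stable under composition with integer matrices. *)
Definition image_dense L r (eps : R) (psi : 'M[int]_(L, r)) (t : torus R L)
    (I : Type) (y : I -> torus R L) : Prop :=
  forall z : torus R r, exists i : I,
    (exists z', y i = t + torus_mul psi z') /\ coords_near eps (y i - (t + torus_mul psi z)).

Lemma torus_mulD m n (P : 'M[int]_(m, n)) (x y : torus R n) :
  torus_mul P (x + y) = torus_mul P x + torus_mul P y.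
Proof.
have := torus_mulB P (x + y) y; rewrite addrK => ->.
by rewrite subrK.
Qed.

Lemma torus_mulA m n p (P : 'M[int]_(m, n)) (Q : 'M[int]_(n, p)) (x : torus R p) :
  torus_mul (P *m Q) x = torus_mul P (torus_mul Q x).
Proof. by apply/colP => i; rewrite !torus_mulE row_mul dot_torus_mul. Qed.

Lemma torus_mul1 n (x : torus R n) : torus_mul 1%:M x = x.
Proof. by apply/colP => i; rewrite torus_mulE row1 dot_delta. Qed.

Lemma coords_near_torus_mul m n (P : 'M[int]_(m, n)) (x : torus R n) (eps eps' : R) (B : nat) :
  coords_near eps x -> (forall i j, (absz (P i j) <= B)%N) -> 0 <= eps ->
  (n * B)%:R * eps <= eps' ->
  coords_near eps' (torus_mul P x).
Proof.
move=> hx hP e0 he i.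
have hx' j : exists w, toc w = x j 0 /\ `|w| <= eps by have [w ? ?] := hx j; exists w.
have [w hw] := choice hx'.
exists (\sum_j w j *~ P i j).
  rewrite torus_mulE /dot (raddf_sum (@toc R)); apply: eq_bigr => j _.
  by rewrite -[LHS]/(toc _) tocMz (hw j).1 mxE.
apply: le_trans (ler_norm_sum _ _ _) _; apply: le_trans he.
apply: (@le_trans _ _ (\sum_(j < n) B%:R * eps)); last first.
  by rewrite sumr_const card_ord natrM -mulrA -[leLHS]mulr_natl.
apply: ler_sum => j _; rewrite -mulrzr normrM mulrC.
apply: ler_pM => //; last exact: (hw j).2.
by rewrite -intr_norm -abszE -[B%:R]/((B%:Z)%:~R) ler_int lez_nat hP.
Qed.

Lemma torus_mul_evalA0 L N D (A : nat -> 'M[int]_(L, N)) (v : 'rV[int]_L) (x : torus R N) n :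
  (forall d, (d <= D)%N -> dot (v *m A d) x = 0) -> dot (v *m evalA D A n) x = 0.
Proof.
move=> h; rewrite dot_evalA big1 // => d _; rewrite h ?mul0rn //.
by rewrite -ltnS.
Qed.

(* Maps [T^L] onto the identity component of the kernel of [v] (when [v 0 l] is
   nonzero); avoids completing [v] to a unimodular matrix, at the cost of having to
   divide points by [v 0 l]. *)
Definition hyperplane_param L (l : 'I_L.+1) (v : 'rV[int]_L.+1) : 'M[int]_(L.+1, L) :=
  \matrix_(i, j) if unlift l i is Some i' then v 0 l *+ (i' == j) else - v 0 (lift l j).

Lemma row_hyperplane_param L (l : 'I_L.+1) v j :
  row (lift l j) (hyperplane_param l v) = v 0 l *: delta_mx 0 j.
Proof.
apply/rowP => j'; rewrite !mxE liftK eqxx /= [j' == j]eq_sym.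
by case: (j == j'); rewrite ?mulr1 ?mulr0.
Qed.

Lemma row'_evalA L N D (A : nat -> 'M[int]_(L.+1, N)) l n :
  evalA D (fun d => row' l (A d)) n = row' l (evalA D A n).
Proof.
apply/matrixP => i j; rewrite /evalA mxE !summxE; apply: eq_bigr => d _.
by rewrite !mxE.
Qed.

Lemma dot_lift L (l : 'I_L.+1) (v : 'rV[int]_L.+1) (y : torus R L.+1) :
  dot v y = y l 0 *~ v 0 l + \sum_j y (lift l j) 0 *~ v 0 (lift l j).
Proof. by rewrite /dot (bigD1_ord l). Qed.

(** For y a point divided by v_l, the left side is the original point. The last term depends only on
    v . y, so points sharing that value lie in one coset. *)
Lemma hyperplane_paramK L (l : 'I_L.+1) (v : 'rV[int]_L.+1) (y : torus R L.+1) :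
  \col_i (y i 0 *~ v 0 l) = torus_mul (hyperplane_param l v) (row' l y) +
    \col_i (if i == l then dot v y else 0).
Proof.
apply/colP => i; rewrite mxE [RHS]mxE torus_mulE [X in _ + X]mxE.
case: (unliftP l i) => [j ->|->].
  by rewrite row_hyperplane_param dotZl dot_delta !mxE eq_sym (negPf (neq_lift l j)) addr0.
rewrite eqxx (dot_lift l) addrC [X in _ + X](_ : _ = - \sum_j y (lift l j) 0 *~ v 0 (lift l j)).
  by rewrite addrK.
rewrite /dot -sumrN; apply: eq_bigr => j _.
by rewrite !mxE unlift_none mulrNz.
Qed.

Lemma row'_torus_mul L N (A : 'M[int]_(L.+1, N)) l (x : torus R N) :
  row' l (torus_mul A x) = torus_mul (row' l A) x.
Proof. by apply/colP => i; rewrite !mxE; apply: eq_bigr => j _; rewrite mxE. Qed.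

(** A test vector for the shortened matrices is extended by 0 at [l]. *)
Lemma cond_b_row' L N D (A : nat -> 'M[int]_(L.+1, N)) l :
  cond_b D A -> cond_b D (fun d => row' l (A d)).
Proof.
move=> hA v w h.
have e d : v *m map_mx (intr : int -> rat) (row' l (A d)) = v *m row' l 1%:M *m map_mx intr (A d).
  by rewrite -mulmxA row'Esub mul_rowsub_mx mul1mx map_row' row'Esub.
by rewrite e; apply: hA => d hd; rewrite -e h.
Qed.

(** The density hypothesis ranges over every nonzero [psi], not only the identity, so that it
    descends to T^(L-1) by composition with [hyperplane_param]. *)
Lemma common_kernel N D L : exists2 X, poly_bounded X &
  forall T (A : nat -> 'M[int]_(L, N)) k (x : 'I_k -> torus R N),
  (2 <= T)%N ->
  (forall d i j, (1 <= d <= D)%N -> (absz (A d i j) <= T)%N) -> cond_b D A ->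
  (forall n r (psi : 'M[int]_(L, r)) t, (1 <= n)%N -> psi != 0 ->
     ~ image_dense T%:R^-1 psi t (fun i => torus_mul (evalA D A n) (x i))) ->
  exists2 I : {set 'I_k}, (k <= #|I| * X T)%N &
    forall i j, i \in I -> j \in I -> forall d, (d <= D)%N ->
      torus_mul (A d) (x i - x j) = 0.
Proof.
elim: L => [|L [X pX IH]].
  exists (fun=> 1%N); first exact: poly_bounded_cst.
  move=> T A k x _ _ _ _; exists [set: 'I_k]%SET; first by rewrite cardsT card_ord muln1.
  by move=> i j _ _ d _; apply/colP => -[].
have [Y pY hY] := @rational_relation R L.+1 N D isT.
(* Applying [hyperplane_param] enlarges distances by at most L Y, so scale 1/T' upstairs becomes at
   most 1/T in the target. *)
pose T' T := (T * (L * Y T).+2)%N.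
exists (fun T => X (T' T) * Y T ^ D.+1 * Y T)%N.
  have pT' : poly_bounded T'.
    apply: poly_boundedM; first exact: poly_bounded_id.
    under eq_fun do rewrite -addn2.
    by repeat (exact: pY || apply: poly_boundedM || apply: poly_boundedD ||
               apply: poly_bounded_cst).
  apply: poly_boundedM => //; apply: poly_boundedM; last exact: poly_boundedX.
  by apply: poly_bounded_comp => // T T2; rewrite /T'; nia.
move=> T A k x T2 hA hb hx.
have [k0|k0] := posnP k.
  by exists finset.set0; [rewrite k0|move=> i j; rewrite inE].
have Tpos : 0 < (T%:R : R) by rewrite ltr0n; lia.
have [|v [I0 [v0 hv hI0 rel0]]] := hY T A k x T2 k0 hA hb.
  move=> n n1; have h1 : (1%:M : 'M[int]_L.+1) != 0.
    by apply/eqP => /matrixP/(_ 0 0); rewrite !mxE eqxx.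
  have /existsNP[s hs] := hx n _ _ 0 n1 h1.
  exists s => i hi; apply: hs; exists i; split.
    by exists (torus_mul (evalA D A n) (x i)); rewrite torus_mul1 add0r.
  by rewrite torus_mul1 add0r.
have [l vl] : exists l, v 0 l != 0.
  apply: contrapT => hn; move/eqP: v0; apply; apply/rowP => l; rewrite mxE.
  by apply: contrapT => h; apply: hn; exists l; apply/eqP.
pose m := absz (v 0 l).
have m0 : (0 < m)%N by rewrite absz_gt0.
have Hxt i : exists y : torus R N, forall j, y j 0 *~ v 0 l = x i j 0.
  have [y hy] := choice (fun j => circle_divr (x i j 0) vl).
  by exists (\col_j y j) => j; rewrite mxE.
have {Hxt}[xt hxt] := choice Hxt.
have dot_xt i j (u : 'rV[int]_N) : dot u (x i - x j) = dot u (xt i - xt j) *~ v 0 l.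
  rewrite /dot mulrz_suml; apply: eq_bigr => e _.
  by rewrite !mxE -!hxt -mulrzBl mulrzAC.
have [f hf] := @circle_torsion R m m0.
have Y0 : (0 < Y T)%N by apply: leq_trans (hv l).
have I00 : (0 < #|I0|)%N by move: hI0; case: #|I0|; lia.
have [i0 i0I] : exists i, i \in I0 by apply/card_gt0P.
(* The relation holds for v_l times the divided points, so it leaves a v_l-torsion ambiguity for
   each d; colouring by these torsion values costs the factor Y^(D+1). *)
pose tau d i := dot (v *m A d) (xt i - xt i0).
have tau0 d i : i \in I0 -> (d <= D)%N -> tau d i *+ m = 0.
  move=> iI dD; have h : tau d i *~ v 0 l = 0 by rewrite -dot_xt rel0.
  have [e|e] := eqVneq (m%:Z) (v 0 l); first by rewrite -[LHS]/(_ *~ m%:Z) e.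
  have e' : m%:Z = - v 0 l by move: e; rewrite /m; move: (v 0 l) => a; lia.
  by rewrite -[LHS]/(_ *~ m%:Z) e' mulrNz h oppr0.
have [|g hg] := @pigeonhole _ {ffun 'I_D.+1 -> 'I_m} I0
  (fun i => [ffun d : 'I_D.+1 => f (tau d i)]).
  by rewrite card_ffun !card_ord expn_gt0 m0.
set I1 := [set i in I0 | _] in hg; rewrite card_ffun !card_ord in hg.
have rel1 i j d : i \in I1 -> j \in I1 -> (d <= D)%N -> dot (v *m A d) (xt i - xt j) = 0.
  rewrite !inE => /andP[iI /eqP ei] /andP[jI /eqP ej] dD.
  have e : tau d i = tau d j.
    apply: hf; rewrite ?tau0 //.
    have := congr1 (fun h : {ffun 'I_D.+1 -> 'I_m} => h (inord d)) (etrans ei (esym ej)).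
    by rewrite !ffunE inordK.
  rewrite (_ : xt i - xt j = (xt i - xt i0) - (xt j - xt i0)); last by rewrite opprB addrA subrK.
  by rewrite dotBr -/(tau d i) -/(tau d j) e subrr.
have I10 : (0 < #|I1|)%N by move: hg I00; case: #|I1|; lia.
have [i1 i1I] : exists i, i \in I1 by apply/card_gt0P.
pose B d := row' l (A d).
pose x' (a : 'I_#|I1|) := xt (enum_val a).
pose Ey n : torus R L.+1 :=
  \col_i (if i == l then dot (v *m evalA D A n) (xt i1) else 0).
have param n i : i \in I1 -> torus_mul (evalA D A n) (x i) =
    torus_mul (hyperplane_param l v) (torus_mul (evalA D B n) (xt i)) + Ey n.
  move=> iI; rewrite row'_evalA -row'_torus_mul.
  have e : dot v (torus_mul (evalA D A n) (xt i)) = dot (v *m evalA D A n) (xt i1).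
    rewrite dot_torus_mul; apply/eqP; rewrite -subr_eq0 -dotBr; apply/eqP.
    by apply: torus_mul_evalA0 => d dD; exact: rel1.
  rewrite /Ey -e -hyperplane_paramK; apply/colP => j.
  rewrite [RHS]mxE !torus_mulE /dot mulrz_suml; apply: eq_bigr => a _.
  by rewrite -hxt mulrzAC.
have T'2 : (2 <= T' T)%N by rewrite /T'; nia.
have [|||I' hI' rel'] := IH (T' T) B #|I1| x' T'2.
- move=> d i j hd; rewrite mxE; apply: leq_trans (hA _ _ _ hd) _.
  by rewrite leq_pmulr.
- exact: cond_b_row'.
- move=> n r psi t n1 psi0 hd.
  apply: (hx n r (hyperplane_param l v *m psi)
    (torus_mul (hyperplane_param l v) t + Ey n) n1).
    (* Outside row [l] the parametrization is v_l times the identity, so it kills no nonzero integer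
       matrix. *)
    apply: contra_neq psi0 => e; apply/matrixP => i j; rewrite [RHS]mxE.
    have : row (lift l i) (hyperplane_param l v *m psi) 0 j = 0 by rewrite e !mxE.
    rewrite row_mul row_hyperplane_param -scalemxAl -rowE !mxE.
    by move/eqP; rewrite mulf_eq0 (negPf vl) => /eqP.
  move=> z; have [a [[z' hz'] ha]] := hd z.
  exists (enum_val a); have aI := enum_valP a.
  have sub (y z'' : torus R L) : torus_mul (hyperplane_param l v) y + Ey n -
     (torus_mul (hyperplane_param l v) t + Ey n + torus_mul (hyperplane_param l v) z'') =
     torus_mul (hyperplane_param l v) (y - (t + z'')).
    rewrite torus_mulB torus_mulD [X in _ - X]addrAC opprD addrACA subrr addr0 //.
  split.
    exists z'; rewrite param // -/(x' a) hz' torus_mulD torus_mulA.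
    by rewrite addrAC.
  rewrite param // torus_mulA sub.
  apply: (coords_near_torus_mul (B := Y T) ha).
  + move=> i j; rewrite mxE; case: unlift => [i'|].
      by case: (i' == j); rewrite ?mulr1n ?mulr0n ?hv.
    by rewrite abszN.
  + by rewrite invr_ge0.
  + rewrite ler_pdivrMr; last by rewrite ltr0n; lia.
    rewrite /T' [X in _ <= _ * X]natrM mulKf ?lt0r_neq0 // ler_nat; lia.
have inj : injective (@enum_val _ (mem I1)) by exact: enum_val_inj.
exists (enum_val @: I')%SET.
  rewrite card_imset //; apply: leq_trans hI0 _; rewrite !mulnA leq_mul //.
  apply: leq_trans hg _; rewrite leq_mul //.
  by rewrite leq_exp_base // hv.
move=> i j /imsetP[a aI ->] /imsetP[b bI ->] d dD.
apply/colP => e; rewrite torus_mulE dot_xt [RHS]mxE.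
have aI1 := enum_valP a; have bI1 := enum_valP b.
have hl e' : dot (row (lift l e') (A d)) (x' a - x' b) = 0.
  have /colP/(_ e') := rel' a b aI bI d dD.
  rewrite torus_mulE [RHS]mxE => <-; congr (dot _ _).
  by apply/rowP => j'; rewrite !mxE.
(* The deleted row is recovered from the relation v: once the other rows vanish, it reads v_l times
   row [l], and this factor v_l is exactly the one relating [x] to [xt]. *)
case: (unliftP l e) => [e' ->|->]; first by rewrite hl mul0rz.
have := rel1 _ _ d aI1 bI1 dD; rewrite -dot_torus_mul (dot_lift l) big1 ?addr0.
  by rewrite torus_mulE.
by move=> e' _; rewrite torus_mulE hl mul0rz.
Qed.

End Induction.

(** * Images of integer matrices are subtori *)

Section Topology.
Variable R : realType.

Lemma continuous_toc : continuous (@toc R).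
Proof. by apply/continuousP => A oA; exact: oA. Qed.

Lemma continuous_circle (f : circle R -> R) : continuous (f \o @toc R) -> continuous f.
Proof. by move=> /continuousP cf; apply/continuousP => A oA; exact: cf. Qed.

Lemma continuous_cosc : continuous (@cosc R).
Proof.
apply: continuous_circle.
rewrite (_ : _ \o _ = fun a => cos (pi *+ 2 * a)); last first.
  by apply/funext => a; rewrite /= cosc_toc.
move=> a; apply: continuous_comp; last exact: continuous_cos.
exact: mulrl_continuous.
Qed.

Lemma continuous_sinc : continuous (@sinc R).
Proof.
apply: continuous_circle.
rewrite (_ : _ \o _ = fun a => sin (pi *+ 2 * a)); last first.
  by apply/funext => a; rewrite /= sinc_toc.
move=> a; apply: continuous_comp; last exact: continuous_sin.
exact: mulrl_continuous.
Qed.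

Lemma continuous_mx_coord (T : topologicalType) m n i j :
  continuous (fun X : 'M[T]_(m, n) => X i j).
Proof.
move=> X A hA; exists (fun i' j' => [set y | i' = i /\ j' = j -> A y]); last first.
  by move=> Y hY; exact: hY.
move=> i' j'; have [[-> ->]|h] := pselect (i' = i /\ j' = j).
  by apply: filterS hA => y Ay _.
by apply: filterE => y /h.
Qed.

Lemma continuous_mx (T U : topologicalType) m n (f : T -> 'M[U]_(m, n)) :
  (forall i j, continuous (fun x => f x i j)) -> continuous f.
Proof.
move=> cf x A [P hP PA].
have h : \forall y \near x, forall ij : 'I_m * 'I_n, P ij.1 ij.2 (f y ij.1 ij.2).
  by apply: filter_forall => -[i j]; exact: (cf i j x _ (hP i j)).
by apply: filterS h => y hy; apply: PA => i j; exact: (hy (i, j)).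
Qed.

Lemma cluster_continuous (T : topologicalType) (f : T -> R) (p q : T) :
  continuous f -> cluster (nbhs p) q -> f p = f q.
Proof.
move=> cf hpq; apply: (@Rhausdorff R) => A B hA hB.
by have [z [Az Bz]] := hpq _ _ (cf p _ hA) (cf q _ hB); exists (f z).
Qed.

(** Cosine and sine are continuous and together separate the points of the circle. *)
Lemma torus_hausdorff n : hausdorff_space (torus R n).
Proof.
move=> p q hpq; apply/colP => i.
have c1 : cosc (p i 0) = cosc (q i 0).
  apply: (cluster_continuous (f := fun X : torus R n => cosc (X i 0)) _ hpq) => X.
  by apply: continuous_comp; [exact: continuous_mx_coord|exact: continuous_cosc].
have s1 : sinc (p i 0) = sinc (q i 0).
  apply: (cluster_continuous (f := fun X : torus R n => sinc (X i 0)) _ hpq) => X.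
  by apply: continuous_comp; [exact: continuous_mx_coord|exact: continuous_sinc].
apply/eqP; rewrite -subr_eq0; apply/eqP/cosc_eq1.
by rewrite coscB c1 s1 -!expr2 cosc2Dsinc2.
Qed.

(** Through real lifts: closed as the image of the compact unit cube, connected as a union of images
    of lines through 0, and nontrivial because divisibility yields a point with a coordinate 1/2. *)
Lemma subtorus_image L r (psi : 'M[int]_(L, r)) :
  psi != 0 -> subtorus (range (torus_mul psi : torus R r -> torus R L)).
Proof.
move=> psi0.
pose g (v : 'rV[R]_r) : torus R L := \col_i toc (\sum_j v 0 j * (psi i j)%:~R).
have gE (v : 'rV[R]_r) : torus_mul psi (\col_j toc (v 0 j)) = g v.
  apply/colP => i; rewrite !mxE (raddf_sum (@toc R)); apply: eq_bigr => j _.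
  by rewrite mxE -tocMz mulrzr.
have torus_mul0 : torus_mul psi (0 : torus R r) = 0.
  by have := torus_mulB psi (0 : torus R r) 0; rewrite !subrr.
have cg : continuous g.
  apply: continuous_mx => i j v.
  under [X in continuous_at v X]eq_fun do rewrite mxE.
  apply: (@continuous_comp _ _ _ (fun v : 'rV[R]_r => \sum_j v 0 j * (psi i j)%:~R) (@toc R)).
    apply: continuous_big => [|j' _ w]; first exact: add_continuous.
    apply: (@continuous_comp _ _ _ (fun v : 'rV[R]_r => v 0 j') (fun a => a * (psi i j')%:~R)).
      exact: continuous_mx_coord.
    exact: mulrr_continuous.
  exact: continuous_toc.
split.
- by exists 0.
- by move=> _ _ [x _ <-] [y _ <-]; exists (x - y) => //; rewrite torus_mulB.
- have [i [j hij]] : exists i j, psi i j != 0.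
    apply: contrapT => hn; move/eqP: psi0; apply; apply/matrixP => i j.
    by rewrite mxE; apply: contrapT => h; apply: hn; exists i, j; apply/eqP.
  have [y hy] := @circle_divr R (toc (1 / 2)) _ hij.
  move=> h; have : range (torus_mul psi) (torus_mul psi (\col_j' if j' == j then y else 0)).
    by eexists.
  rewrite h => /colP/(_ i); rewrite !mxE (bigD1 j) //= big1 ?addr0; last first.
    by move=> j' jj'; rewrite !mxE (negPf jj') mul0rz.
  rewrite mxE eqxx hy => /(congr1 (@cosc R)); rewrite cosc_toc cosc0.
  rewrite (_ : pi *+ 2 * (1 / 2) = pi); last by field.
  by rewrite cospi => /eqP; rewrite -subr_eq0 -opprD oppr_eq0 -(natrD _ 1 1) pnatr_eq0.
- apply: compact_closed; first exact: torus_hausdorff.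
  rewrite (_ : range _ =
    g @` [set v : 'rV[R]_r | forall i, `[0, 1]%classic (v ord0 i)]); last first.
    rewrite eqEsubset; split => [_ [x _ <-]|_ [v _ <-]]; last first.
      by exists (\col_j toc (v 0 j)) => //; rewrite gE.
    have h j : exists a, `[0, 1]%classic a /\ toc a = x j 0.
      have [w hw w2] := circle_half (x j 0); rewrite ler_norml in w2.
      have [w0|w0] := lerP 0 w.
        by exists w; split=> //; rewrite /= in_itv /=; apply/andP; split; lra.
      exists (w + 1); split; first by rewrite /= in_itv /=; apply/andP; split; lra.
      by rewrite -hw; apply/toc_eq; rewrite addrAC subrr add0r.
    have [a ha] := choice h.
    exists (\row_j a j); first by move=> j /=; rewrite mxE; exact: (ha j).1.
    rewrite -gE; congr (torus_mul _ _); apply/colP => j; rewrite !mxE; exact: (ha j).2.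
  apply: continuous_compact; first exact: continuous_subspaceT.
  by apply: (@rV_compact R r (fun=> `[0, 1]%classic)) => i; exact: segment_compact.
- rewrite (_ : range _ = \bigcup_(v in [set: 'rV[R]_r])
     range (fun t : R => \col_i toc (t * \sum_j v 0 j * (psi i j)%:~R) : torus R L)); last first.
    rewrite eqEsubset; split => [_ [x _ <-]|_ [v _ [t _ <-]]].
      exists (\row_j repr (x j 0)) => //; exists 1 => //.
      transitivity (g (\row_j repr (x j 0))).
        by apply/colP => i; rewrite !mxE mul1r.
      rewrite -gE; congr (torus_mul _ _); apply/colP => j.
      by rewrite !mxE reprK_toc.
    exists (\col_j toc ((t *: v) 0 j)) => //; rewrite gE; apply/colP => i; rewrite !mxE.
    by rewrite mulr_sumr; congr toc; apply: eq_bigr => j _; rewrite mxE mulrA.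
  apply: bigcup_connected.
    exists 0 => v _; exists 0 => //; apply/colP => i.
    by rewrite !mxE mul0r toc0.
  move=> v _; apply: connected_continuous_connected.
    by apply/connected_intervalP.
  apply: continuous_subspaceT; apply: continuous_mx => i j t.
  under [X in continuous_at t X]eq_fun do rewrite mxE.
  apply: (@continuous_comp _ _ _ (fun t : R => t * \sum_j v 0 j * (psi i j)%:~R) (@toc R)).
    exact: mulrr_continuous.
  exact: continuous_toc.
Qed.

Lemma coords_near_torus_norm n (eps : R) (x : torus R n) :
  0 <= eps -> coords_near eps x -> torus_norm x <= eps.
Proof.
move=> e0 hx; rewrite /torus_norm /dist_int.
have hx' j : exists wz : R * int, repr (x j 0) - wz.2%:~R = wz.1 /\ `|wz.1| <= eps.
  have [w hw we] := hx j.
  have [z hz] := repr_toc w; exists (w, z); split => //=.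
  by rewrite -hw hz addrK.
have [wz hwz] := choice hx'.
pose X := map_mx (repr : circle R -> R) x - map_mx intr (\col_j (wz j).2).
apply: (@le_trans _ _ `|X|).
  apply: ge_inf; last by exists (\col_j (wz j).2).
  by exists 0 => _ [z _ <-]; exact: normr_ge0.
rewrite /Num.norm /= mx_normrE; apply/bigmax_leP; split => // -[i j] _ /=.
by rewrite (ord1 j) !mxE (hwz i).1; exact: (hwz i).2.
Qed.

End Topology.

(** * Counting and conclusion *)

Section Final.
Variable R : realType.

Lemma image_dense_eps_dense L r (delta eps : R) (psi : 'M[int]_(L, r)) (t : torus R L) I
    (y : I -> torus R L) : 0 <= delta -> delta <= eps ->
  image_dense delta psi t y -> eps_dense eps (range y) (translate t (range (torus_mul psi))).
Proof.
move=> d0 de hd _ [_ [z _ <-] <-].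
have [i [[z' hz'] hi]] := hd z.
exists (y i); last by apply: le_trans de; exact: coords_near_torus_norm.
split; first by exists i.
by exists (torus_mul psi z'); rewrite // -hz'.
Qed.

Lemma torus_norm_le_half n (x : torus R n) : torus_norm x <= 1 / 2.
Proof. by apply: coords_near_torus_norm => // i; exact: circle_half. Qed.

Lemma eval_mxE L N D (A : 'M[{poly int}]_(L, N)) n :
  (forall i j, (size (A i j) <= D.+1)%N) -> eval_mx A n = evalA D (coef_mx A) n.
Proof.
move=> hA; apply/matrixP => i j; rewrite /evalA !mxE summxE.
rewrite (horner_coef_wide _ (hA i j)); apply: eq_bigr => d _.
by rewrite !mxE mulrC -[(n ^ d)%:Z]natz natrX natz.
Qed.

(** The claimed bound tends to 0 as eps grows, so this range is treated apart: a single point is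
    already eps-dense in the whole torus. *)
Lemma admissible_large_eps (eps : R) L N (A : 'M[{poly int}]_(L, N)) k :
  (0 < L)%N -> 1 / 2 <= eps -> admissible eps A k -> k = 0%N.
Proof.
case: L A => [//|L] A _ e2 [x [_ hx]]; case: k x hx => [//|k] x hx.
have h1 : (1%:M : 'M[int]_L.+1) != 0.
  by apply/eqP => /matrixP/(_ 0 0); rewrite !mxE eqxx.
exfalso; apply: (hx 1%N isT _ (torus_mul (eval_mx A 1) (x 0)) (subtorus_image R h1)).
move=> s _; exists (torus_mul (eval_mx A 1) (x 0)); last exact: le_trans (torus_norm_le_half _) e2.
split; first by exists 0.
by exists 0; [exists 0; rewrite // torus_mul1|rewrite addr0].
Qed.

Lemma height_coef_le (p : {poly int}) d : (absz (p`_d)%R <= height p)%N.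
Proof.
have [hd|hd] := ltnP d (size p); last by rewrite nth_default.
exact: (@leq_bigmax _ (fun d : 'I_(size p) => absz (p`_d)%R) (Ordinal hd)).
Qed.

Lemma height_mx_coef_le L N (A : 'M[{poly int}]_(L, N)) i j d :
  (absz ((A i j)`_d)%R <= height_mx A)%N.
Proof.
apply: leq_trans (height_coef_le _ _) _.
apply: leq_trans (@leq_bigmax _ (fun j => height (A i j)) j) _.
exact: (@leq_bigmax _ (fun i => \max_j height (A i j))%N i).
Qed.

Lemma coef_star_mx L N (A : 'M[{poly int}]_(L, N)) i j d :
  (star_mx A i j)`_d = if d == 0%N then 0 else coef_mx A d i j.
Proof.
rewrite !mxE coefB coefC /=; case: d => [|d] /=; first by rewrite subrr.
by rewrite subr0.
Qed.

Lemma height_star_mx_gt0 L N (A : 'M[{poly int}]_(L, N)) : (0 < N)%N ->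
  columns_Qfree (star_mx A) -> (0 < height_mx (star_mx A))%N.
Proof.
move=> N0 hA; rewrite lt0n; apply/negP => /eqP h0.
have z i j : star_mx A i j = 0.
  apply/polyP => d; rewrite coef0; apply/eqP; rewrite -absz_eq0 -leqn0 -h0.
  exact: height_mx_coef_le.
suff /(_ (Ordinal N0))/eqP : forall j, (fun _ : 'I_N => 1 : rat) j = 0 by rewrite oner_eq0.
apply: hA; apply: big1 => j _; apply/colP => i.
by rewrite mxE [X in _ * X]mxE [X in _ * X]mxE z map_poly0 mulr0 mxE.
Qed.

(** The map w -> (A_d w) for 1 <= d <= D as one matrix; the [.+1] skips degree 0. *)
Definition stacked_coefs L N D (A : 'M[{poly int}]_(L, N)) :=
  \matrix_(a < #|{: 'I_D * 'I_L}|, j < N) coef_mx A (enum_val a).1.+1 (enum_val a).2 j.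

(** A column of the cokernel is a rational relation among the columns of A_*, hence zero by (a). *)
Lemma unit_rows_in_rowspace L N D (A : 'M[{poly int}]_(L, N)) :
  (forall i j, (size (A i j) <= D.+1)%N) -> columns_Qfree (star_mx A) ->
  forall j : 'I_N, (map_mx (intr : int -> rat) (delta_mx 0 j : 'rV_N) <=
    map_mx (intr : int -> rat) (stacked_coefs D A))%MS.
Proof.
move=> sA hA j; rewrite submxE; apply/eqP/matrixP => i0 c; rewrite [RHS]mxE.
set C := cokermx _.
suff C0 : forall i, C i c = 0 by rewrite mxE big1 // => i _; rewrite C0 mulr0.
apply: hA; apply/colP => l; apply/polyP => d.
rewrite summxE [in RHS]mxE coef0 coef_sum.
have e i : (((C i c)%:P *: col i (map_mx (map_poly (intr : int -> rat)) (star_mx A))) l 0)`_d =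
    C i c * (if d == 0%N then 0 else coef_mx A d l i)%:~R.
  have -> : ((C i c)%:P *: col i (map_mx (map_poly (intr : int -> rat)) (star_mx A))) l 0 =
      (C i c)%:P * map_poly intr (star_mx A l i).
    by rewrite mxE [X in _ * X]mxE [X in _ * X]mxE.
  by rewrite coefCM coef_map -coef_star_mx.
rewrite (eq_bigr _ (fun i _ => e i)) {e}.
case: d => [|d] /=; first by rewrite big1 // => i _; rewrite mulr0.
have [dD|dD] := ltnP d D; last first.
  apply: big1 => i _; rewrite (_ : coef_mx A d.+1 l i = 0) ?mulr0 // mxE /=.
  rewrite nth_default //.
  exact: leq_trans (sA l i) _.
have := mulmx_coker (map_mx (intr : int -> rat) (stacked_coefs D A)) => /matrixP.
move=> /(_ (enum_rank (Ordinal dD, l)) c); rewrite !mxE => h.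
rewrite -[RHS]h; apply: eq_bigr => i _.
by rewrite !mxE enum_rankK /= mulrC.
Qed.

(** Cramer's rule puts a bounded multiple of each unit row in the integer row span, so every
    coordinate of a difference is torsion of bounded order [q], leaving at most q^N points. *)
Lemma kernel_card L N D : exists2 X, poly_bounded X &
  forall T (A : 'M[{poly int}]_(L, N)) k (x : 'I_k -> torus R N) (I : {set 'I_k}),
  (2 <= T)%N ->
  (forall i j, (size (A i j) <= D.+1)%N) -> columns_Qfree (star_mx A) ->
  (height_mx (star_mx A) <= T)%N -> injective x ->
  (forall i j, i \in I -> j \in I -> forall d, (d <= D)%N ->
      torus_mul (coef_mx A d) (x i - x j) = 0) ->
  (#|I| <= X T)%N.
Proof.
pose m := #|{: 'I_D * 'I_L}|.
exists (fun T => 1 + ((m`! * T ^ m) ^ N) ^ N)%N.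
  by repeat (apply: poly_boundedM || apply: poly_boundedD || apply: poly_boundedX ||
             apply: poly_bounded_cst || apply: poly_bounded_id).
move=> T A k x I T2 sA hA hT xinj hI.
have [->|[i0 i0I]] := set_0Vmem I; first by rewrite cards0.
apply: leq_trans (leq_addl _ _).
pose P := stacked_coefs D A.
have hP a j : (absz (P a j) <= T)%N.
  rewrite mxE; apply: leq_trans hT.
  have := height_mx_coef_le (star_mx A) (enum_val a).2 j (enum_val a).1.+1.
  by rewrite coef_star_mx.
have Hr j : exists r : nat, (0 < r <= m`! * T ^ m)%N /\
    exists c : 'rV[int]_m, r%:Z *: delta_mx 0 j = c *m P.
  have [r r1 r2] := rowspace_int_bound (ltnW T2) hP (unit_rows_in_rowspace sA hA j).
  by exists r.
have [r hr] := choice Hr.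
pose q := (\prod_j r j)%N.
have q0 : (0 < q)%N by rewrite prodn_gt0 // => j; have [/andP[]] := hr j.
have qle : (q <= (m`! * T ^ m) ^ N)%N.
  rewrite -[X in (_ <= _ ^ X)%N](card_ord N) -prod_nat_const /q.
  by apply: leq_prod => j _; have [/andP[]] := hr j.
have [f hf] := @circle_torsion R q q0.
have tors i j : i \in I -> (x i - x i0) j 0 *+ q = 0.
  move=> iI; rewrite /q (bigD1 j) //= mulrnA.
  have [_ [c hc]] := hr j.
  rewrite -[X in X *+ r j]dot_delta -[X in X *+ _]/(dot _ _ *~ (r j)%:Z) -dotZl hc.
  rewrite dot_mulmx big1 ?mul0rn // => a _.
  have := hI i i0 iI i0I (enum_val a).1.+1 (ltn_ord _) => /colP/(_ (enum_val a).2).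
  rewrite torus_mulE [RHS]mxE => e.
  rewrite (_ : row a P = row (enum_val a).2 (coef_mx A (enum_val a).1.+1)) ?e ?mul0rz //.
  by apply/rowP => j'; rewrite !mxE.
pose F (i : 'I_k) : {ffun 'I_N -> 'I_q} := [ffun j => f ((x i - x i0) j 0)].
have Finj : {in I &, injective F}.
  move=> i i' iI i'I /ffunP e; apply: xinj; apply/colP => j.
  have := e j; rewrite !ffunE => /hf; rewrite !tors // => /(_ erefl erefl).
  by rewrite !mxE => /addIr.
rewrite -(card_in_imset Finj); apply: leq_trans (max_card _) _.
rewrite card_ffun !card_ord.
exact: leq_exp_base.
Qed.

End Final.

Theorem theorem1p3 (R : realType) (N L D : nat) :
  (0 < N)%N -> (0 < L)%N -> (0 < D)%N ->
  exists c1 c2 C : R,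
  forall A : 'M[{poly int}]_(L, N),
    (forall i j, (size (A i j) <= D.+1)%N) ->
    columns_Qfree (star_mx A) ->
    (forall (v : 'cV[rat]_L) (w : 'cV[rat]_N),
       (forall d : nat, (1 <= d <= D)%N -> v^T *m (coef_mxQ A d *m w) = 0) ->
       v^T *m (coef_mxQ A 0 *m w) = 0) ->
  forall eps : R, 0 < eps ->
  exists k : nat, is_k eps A k /\
    k%:R <= C * (height_mx (star_mx A))%:R `^ c1 * (1 / eps) `^ c2.
Proof.
move=> N0 L0 D0.
have [X [c hX] kX] := common_kernel R N D L.
have [Y [c' hY] kY] := kernel_card R L N D.
(* The count is at most T^c' T^c with T = h E <= 2 h / eps, which gives both exponents and the
   constant. *)
exists (c' + c)%:R, (c' + c)%:R, (2 ^+ (c' + c)) => A sA hA hb eps e0.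
set h := height_mx (star_mx A).
have h0 : (0 < h)%N by exact: height_star_mx_gt0.
have adm0 : admissible eps A 0.
  exists (fun=> 0); split; first by case.
  move=> n _ H t [H0 _ _ _ _] hd.
  have [|y [[i _ _] _] _] := hd (t + 0); first by exists 0.
  by case: i.
have bound k : admissible eps A k ->
    k%:R <= 2 ^+ (c' + c) * h%:R `^ (c' + c)%:R * (1 / eps) `^ (c' + c)%:R.
  move=> hk; have [e2|e2] := lerP (1 / 2) eps.
    by rewrite (admissible_large_eps L0 e2 hk) !mulr_ge0 ?powR_ge0 ?exprn_ge0.
  have [x [xinj hx]] := hk.
  have ie2 : 2 < 1 / eps by rewrite ltr_pdivlMr //; lra.
  have ie0 : 0 <= 1 / eps by apply: ltW; apply: lt_trans ie2.
  pose E := (Num.truncn (1 / eps)).+1.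
  have E1 : 1 / eps < E%:R by exact: truncnS_gt.
  have E2 : E%:R <= 2 * (1 / eps).
    have : (Num.truncn (1 / eps))%:R <= 1 / eps by rewrite truncn_le.
    by rewrite /E -natr1; lra.
  have E3 : (2 <= E)%N by rewrite -(ler_nat R); apply/ltW/(lt_trans ie2).
  pose T := (h * E)%N.
  have T2 : (2 <= T)%N by rewrite /T; nia.
  have ET : (E <= T)%N by rewrite /T leq_pmull.
  have hT : (h <= T)%N by rewrite /T leq_pmulr //; lia.
  have Te : T%:R^-1 <= eps :> R.
    rewrite -[leRHS]invrK lef_pV2 ?posrE ?invr_gt0 ?ltr0n //; last by lia.
    rewrite -[eps^-1]mul1r; apply: le_trans (ltW E1) _.
    by rewrite ler_nat.
  have [|||I hI1 hI2] := kX T (coef_mx A) k x T2.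
  - move=> d i j /andP[d1 _]; apply: leq_trans hT.
    have := height_mx_coef_le (star_mx A) i j d.
    by rewrite coef_star_mx; case: d d1.
  - move=> v w hvw.
    have := hb v^T w; rewrite trmxK !mulmxA; apply => d hd.
    by rewrite mulmxA; exact: hvw.
  - move=> n r psi t n1 psi0 hd.
    apply: (hx n n1 _ t (subtorus_image R psi0)).
    rewrite (eval_mxE n sA); apply: image_dense_eps_dense hd => //.
  have hI3 := kY T A k x I T2 sA hA hT xinj hI2.
  have kT : (k <= T ^ (c' + c))%N.
    apply: leq_trans hI1 _; rewrite expnD leq_mul //; last exact: hX.
    exact: leq_trans hI3 (hY _ T2).
  rewrite !powR_mulrn //.
  rewrite -!exprMn; apply: (@le_trans _ _ ((T ^ (c' + c))%:R)); first by rewrite ler_nat.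
  rewrite natrX lerXn2r ?nnegrE //.
    by apply: mulr_ge0 => //; apply: mulr_ge0.
  by rewrite /T natrM [2 * _]mulrC -mulrA ler_wpM2l.
(* The empty configuration is admissible and [bound] caps all others, so the maximum exists. *)
pose adm := [pred k | `[< admissible eps A k >]].
have exadm : exists k, adm k by exists 0%N; apply/asboolP.
have [B hB] : exists B, forall k, adm k -> (k <= B)%N.
  exists (Num.truncn (2 ^+ (c' + c) * h%:R `^ (c' + c)%:R * (1 / eps) `^ (c' + c)%:R : R)).
  move=> k /asboolP /bound hk; rewrite truncn_ge_nat //.
  by rewrite (le_trans _ hk).
have := ex_maxnP exadm hB; case: ex_maxnP => k /asboolP hk1 hk2 _.
exists k; split; last exact: bound.
by split=> // k' hk'; apply: hk2; apply/asboolP.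
Qed.
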